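(* Let $k>n$ be positive integers. Let $E\subset\mathbb{R}^k$ be a (Lebesgue) measurable set, and let $f\colon E\to\mathbb{H}^n$ be a Lipschitz mapping (with respect to the Euclidean metric on $E$ and the Carnot–Carathéodory metric $d_{cc}$ on $\mathbb{H}^n$). Then $\mathcal{H}^k_{\mathbb{H}^n}(f(E))=0$.
   Context: The Heisenberg group $\mathbb{H}^n$ is $\mathbb{C}^n\times\mathbb{R}=\mathbb{R}^{2n+1}$, with points $(z,t)=(x_1,y_1,\ldots,x_n,y_n,t)$, $z_j=x_j+iy_j$, and group law $(z,t)*(z',t')=\left(z+z',\,t+t'+2\,\mathrm{Im}\sum_{j=1}^n z_j\overline{z_j'}\right)$. The left-invariant vector fields are $X_j=\frac{\partial}{\partial x_j}+2y_j\frac{\partial}{\partial t}$, $Y_j=\frac{\partial}{\partial y_j}-2x_j\frac{\partial}{\partial t}$ ($j=1,\ldots,n$), $T=\frac{\partial}{\partial t}$. The horizontal space at $p$ is $H_p\mathbb{H}^n=\mathrm{span}\{X_1(p),\ldots,X_n(p),Y_1(p),\ldots,Y_n(p)\}$, equipped with the inner product making these $2n$ vectors orthonormal. An absolutely continuous curve $\gamma\colon[a,b]\to\mathbb{R}^{2n+1}$ is horizontal if $\gamma'(s)\in H_{\gamma(s)}\mathbb{H}^n$ for almost every $s$; its length is the integral of the norm of $\gamma'$ with respect to this inner product. The Carnot–Carathéodory metric $d_{cc}(p,q)$ is the infimum of lengths of horizontal curves joining $p$ to $q$. $\mathbb{H}^n$ is always regarded as the metric space $(\mathbb{H}^n,d_{cc})$.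 $\mathcal{H}^k_{\mathbb{H}^n}$ denotes the $k$-dimensional Hausdorff measure on $\mathbb{H}^n$ with respect to $d_{cc}$. *)

(* Defs.v *)
From HB Require Import structures.
From mathcomp Require Import all_boot all_order all_algebra.
From mathcomp Require Import all_classical all_reals all_analysis.

Set Implicit Arguments.
Unset Strict Implicit.
Unset Printing Implicit Defensive.

Import Order.TTheory GRing.Theory Num.Theory.
Import numFieldNormedType.Exports.

Local Open Scope classical_set_scope.
Local Open Scope ring_scope.

(* The point (x, y, t) has z_j = x_j + i y_j; the normed-space structure is
   the library's one on products, so that derivatives and absolute continuity
   of curves are those of curves in R^(2n+1). *)
Notation heis R n := ('rV[R]_n * 'rV[R]_n * R)%type.

Section CarnotCaratheodory.
Context {R : realType} {n : nat}.
Implicit Types (p q v w : heis R n) (gamma : R -> heis R n).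

Definition hx p : 'rV[R]_n := p.1.1.
Definition hy p : 'rV[R]_n := p.1.2.

Definition fieldX (j : 'I_n) p : heis R n :=
  (delta_mx ord0 j, 0, 2 * hy p ord0 j).
Definition fieldY (j : 'I_n) p : heis R n :=
  (0, delta_mx ord0 j, - (2 * hx p ord0 j)).

Definition hcomb p (a b : 'I_n -> R) : heis R n :=
  \sum_(j < n) (a j *: fieldX j p + b j *: fieldY j p).

Definition horizontal_space p : set (heis R n) :=
  [set v | exists a b, v = hcomb p a b].

(* The coefficients of a horizontal vector on X_j and Y_j are its x_j and y_j
   components (hcombE below), at every base point; so on each horizontal space
   this is the inner product making the X_j and Y_j orthonormal. *)
Definition hdot v w : R :=
  \sum_(j < n) (hx v ord0 j * hx w ord0 j + hy v ord0 j * hy w ord0 j).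

Definition hnorm v : R := Num.sqrt (hdot v v).

Lemma hcombE p a b (j : 'I_n) :
  hx (hcomb p a b) ord0 j = a j /\ hy (hcomb p a b) ord0 j = b j.
Proof.
have hxS (F : 'I_n -> heis R n) : hx (\sum_i F i) = \sum_i hx (F i).
  exact: (@big_morph _ _ hx _ _ _ _ (fun u v => erefl (hx (u + v))) erefl).
have hyS (F : 'I_n -> heis R n) : hy (\sum_i F i) = \sum_i hy (F i).
  exact: (@big_morph _ _ hy _ _ _ _ (fun u v => erefl (hy (u + v))) erefl).
rewrite /hcomb hxS hyS !summxE; split.
- rewrite (bigD1 j)//= big1 ?addr0; first by rewrite !mxE !eqxx mulr1 mulr0 addr0.
  by move=> i ij; rewrite !mxE (eq_sym j) (negbTE ij) mulr0 mulr0 addr0.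
- rewrite (bigD1 j)//= big1 ?addr0; first by rewrite !mxE !eqxx mulr1 mulr0 add0r.
  by move=> i ij; rewrite !mxE (eq_sym j) (negbTE ij) mulr0 mulr0 addr0.
Qed.

Lemma hdot_hcomb p a b a' b' :
  hdot (hcomb p a b) (hcomb p a' b') =
  \sum_(j < n) (a j * a' j + b j * b' j).
Proof.
apply: eq_bigr => j _.
by have [-> ->] := hcombE p a b j; have [-> ->] := hcombE p a' b' j.
Qed.

Definition absolutely_continuous_on (a b : R) gamma :=
  forall e : R, 0 < e -> exists2 d : R, 0 < d &
    forall (N : nat) (u v : 'I_N -> R),
      (forall i, a <= u i /\ u i <= v i /\ v i <= b) ->
      trivIset setT (fun i => `]u i, v i[%classic) ->
      \sum_(i < N) (v i - u i) < d ->
      \sum_(i < N) `|gamma (v i) - gamma (u i)| < e.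

Definition horizontal_curve (a b : R) gamma :=
  absolutely_continuous_on a b gamma /\
  {ae (@lebesgue_measure R), forall s, s \in `[a, b] ->
    derivable gamma s 1 /\ horizontal_space (gamma s) (derive1 gamma s)}.

Definition cc_length (a b : R) gamma : \bar R :=
  (\int[@lebesgue_measure R]_(s in `[a, b]) (hnorm (derive1 gamma s))%:E)%E.

Definition dcc p q : \bar R :=
  ereal_inf [set L | exists a b gamma,
    [/\ a <= b, horizontal_curve a b gamma, gamma a = p, gamma b = q &
        L = cc_length a b gamma]].

End CarnotCaratheodory.

Section HausdorffMeasure.
Context {R : realType} {T : Type}.
Variable (d : T -> T -> \bar R).
Local Open Scope ereal_scope.

(* The diameter of the empty set is -oo. *)
Definition diam (A : set T) : \bar R := ereal_sup [set d x y | x in A & y in A].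

Definition diam_pow (k : nat) (A : set T) : \bar R :=
  if A == set0 then 0 else diam A ^+ k.

Definition hausdorff_premeasure (k : nat) (delta : R) (A : set T) : \bar R :=
  ereal_inf [set \sum_(0 <= i <oo) diam_pow k (U i) | U in
    [set U : (set T)^nat | A `<=` \bigcup_i U i /\
                           forall i, diam (U i) <= delta%:E]].

(* No normalising constant: other conventions differ by a positive factor
   depending only on k. *)
Definition hausdorff_measure (k : nat) (A : set T) : \bar R :=
  ereal_sup [set hausdorff_premeasure k delta A | delta in [set r : R | (0 < r)%R]].

End HausdorffMeasure.

Section Euclidean.
Context {R : realType} {k : nat}.

(* The library norm on 'rV[R]_k is the sup norm. *)
Definition enorm (x : 'rV[R]_k) : R := Num.sqrt (\sum_(i < k) x ord0 i ^+ 2).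

Definition box (a b : 'rV[R]_k) : set 'rV[R]_k :=
  [set x | forall i, a ord0 i < x ord0 i <= b ord0 i].

Definition box_volume (a b : 'rV[R]_k) : R :=
  \prod_(i < k) Num.max 0 (b ord0 i - a ord0 i).

(* Meaningful for k > 0: for k = 0 there is no empty box. *)
Definition lebesgue_outer (A : set 'rV[R]_k) : \bar R :=
  ereal_inf [set (\sum_(0 <= i <oo) (box_volume (c i).1 (c i).2)%:E)%E | c in
    [set c : ('rV[R]_k * 'rV[R]_k)^nat |
      A `<=` \bigcup_i box (c i).1 (c i).2]].

Definition lebesgue_measurable_set (E : set 'rV[R]_k) : Prop :=
  lebesgue_outer.-caratheodory E.

End Euclidean.

Definition cc_lipschitz_on {R : realType} {n k : nat}
    (E : set 'rV[R]_k) (f : 'rV[R]_k -> heis R n) : Prop :=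
  exists L : R, forall x y, E x -> E y ->
    (dcc (f x) (f y) <= (L * enorm (x - y))%:E)%E.

(* Main.v *)
Require Import Defs.
From HB Require Import structures.
From mathcomp Require Import all_boot all_order all_algebra.
From mathcomp Require Import all_classical all_reals all_analysis.
From mathcomp Require Import measurable_realfun.
From mathcomp Require Import ring lra zify.

(* For horizontal curves the increments of z = (x, y) and the twisted vertical
   increment tau are controlled by the length, and conversely explicit polynomial
   curves give d_cc <= const * (|dz| + sqrt |tau|). So f has a Lipschitz horizontal
   part z o f, which extends to a Lipschitz map on the whole of R^k, and tau obeys a
   quadratic bound.

   No differentiation theorem is needed, because a covering at a single scale is
   enough. Divide the cubes of side M^(-g) into M^k cells. The energies of
   the difference quotients of z o f at step M^(-g) are monotone in g and bounded,
   and so is the number of cells meeting E, suitably normalised; hence by the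
   pigeonhole principle there is a scale at which, in all but few cubes meeting E,
   every cell meets E and the extension of z o f is affine up to the size h of a
   cell. In such a cube any two points of E are joined by a chain of M points of E
   whose image is nearly straight, which gives tau = O(M h^2) instead of the trivial
   O(M^2 h^2). Comparing three points, the k > n slopes have symplectic products
   O(h^2 / M), so they are nearly dependent: a linear algebra argument produces a
   combination of them with norm O(h / sqrt M). The image of the cube is then covered
   by O(M^((k-1)/2)) sets of diameter O(sqrt M * h), of total cost O(M^(-1/2)) times the
   volume of the cube, and M is arbitrary. *)

Set Implicit Arguments.
Unset Strict Implicit.
Unset Printing Implicit Defensive.

Import Order.TTheory GRing.Theory Num.Theory.
Import numFieldNormedType.Exports.

Local Open Scope classical_set_scope.
Local Open Scope ring_scope.

(** * Absolutely continuous functions *)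

(** Only [z o f] is extended beyond [E]; the vertical coordinate is not, and [tau] is estimated only
    between points of [E]. Hence chains must run through [E], and a cube with a cell missing [E] is
    as harmful as one where the slopes vary. Second differences measure the deviation from affine
    maps for two reasons. Writing a difference of step M as a sum of M unit differences, the loss in
    the Cauchy-Schwarz inequality dominates the pure second difference, so a small drop of energy
    makes those small. On a torus, summation by parts has no boundary terms, so the pure ones
    control the mixed ones. The pigeonhole principle does not say which scale is good, so every
    bound is uniform in the scale: the number of cubes cancels the k-th power of their side. The
    parameters are fixed in the order [r0] (with M = r0 ^ 2), then [g0], which makes the sets small,
    then [N]: the cost of the bad cubes is huge in M, but it is divided by the number of available
    scales. Lengths are integrals of derivatives existing almost everywhere, so the lower bounds for
    the distance start from a growth lemma for absolutely continuous functions. *)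

Section Growth.
Context {R : realType}.
Notation mu := (@lebesgue_measure R).

(** Continuous induction: the set [S] of points up to which the estimate holds contains its
    supremum, by left continuity of [phi] and monotonicity of [G], and the growth to the right
    forces this supremum to be [b]. *)
Lemma right_growth_le (a b : R) (phi G : R -> R) : a <= b ->
  {in `[a, b] &, {homo G : x y / x <= y}} ->
  (forall s, a <= s -> s <= b -> forall e, 0 < e ->
     exists2 d, 0 < d & forall t, a <= t -> t <= s -> s - t < d ->
       `|phi s - phi t| < e) ->
  (forall s, a <= s -> s < b ->
     exists2 d, 0 < d & forall t, s <= t -> t <= b -> t - s < d ->
       phi t - phi s <= G t - G s) ->
  phi b - phi a <= G b - G a.
Proof.
move=> ab homoG cphi growth.
pose S := [set s | [/\ a <= s, s <= b & phi s - phi a <= G s - G a]].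
have Sa : S a by split => //; rewrite !subrr.
have supS : has_sup S by split; [exists a|exists b => s []].
set c := sup S.
have ac : a <= c by exact: (sup_upper_bound supS).
have cb : c <= b by apply: ge_sup; [exists a|move=> s []].
have Sc : phi c - phi a <= G c - G a.
  apply/ler_addgt0Pr => e e0.
  have [d d0 cd] := cphi c ac cb e e0.
  have [s [as_ sb Hs] cs] := sup_adherent d0 supS.
  have sc : s <= c by apply: (sup_upper_bound supS).
  have /(cd s as_ sc) : c - s < d by rewrite -/c in cs; lra.
  have : G s <= G c by apply: homoG => //; rewrite in_itv /= ?as_ ?ac.
  by rewrite ltr_norml => Gsc /andP[_ ?]; lra.
have [cltb|] := ltP c b; last by move=> bc; have <- : c = b by lra.
have [d d0 cd] := growth c ac cltb.
pose t := Num.min b (c + d / 2).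
have ct : c < t by rewrite /t lt_min cltb ltrDl divr_gt0.
have tb : t <= b by rewrite /t ge_min lexx.
have td : t - c < d by rewrite /t ltrBlDl gt_min; apply/orP; right; lra.
have : S t.
  by split => //; [lra|have := cd t (ltW ct) tb td; lra].
by move=> /(sup_upper_bound supS) /le_lt_trans/(_ ct); rewrite ltxx.
Qed.

(** The integral of a nonnegative function is a supremum over the simple functions below it, so the
    comparison also covers non-measurable functions. This matters for [cc_length], whose integrand
    is meaningful only almost everywhere. *)
Lemma le_ge0_integral (D1 D2 : set R) (f1 f2 : R -> \bar R) :
  (forall x, D1 x -> 0 <= f1 x)%E -> (forall x, D2 x -> 0 <= f2 x)%E ->
  (forall x, D1 x -> D2 x /\ (f1 x <= f2 x)%E) ->
  (\int[mu]_(x in D1) f1 x <= \int[mu]_(x in D2) f2 x)%E.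
Proof.
move=> f10 f20 f12; rewrite integral_mkcond [leRHS]integral_mkcond.
rewrite ge0_integralTE; last by move=> x; apply: erestrict_ge0.
rewrite ge0_integralTE; last by move=> x; apply: erestrict_ge0.
apply: ereal_sup_le => z [h hf <-]; exists h => // x.
apply: le_trans (hf x) _; rewrite !patchE.
case: ifPn => [|_]; last by case: ifPn => //; rewrite inE => /f20.
by rewrite inE => /f12[D2x ?]; rewrite mem_set.
Qed.

Definition real_ac (a b : R) (phi : R -> R) :=
  forall e : R, 0 < e -> exists2 d : R, 0 < d &
    forall (N : nat) (u v : 'I_N -> R),
      (forall i, a <= u i /\ u i <= v i /\ v i <= b) ->
      trivIset setT (fun i => `]u i, v i[%classic) ->
      \sum_(i < N) (v i - u i) < d ->
      \sum_(i < N) `|phi (v i) - phi (u i)| < e.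

Lemma real_ac_cont a b phi : real_ac a b phi ->
  forall e, 0 < e -> exists2 d, 0 < d & forall s t, a <= t -> t <= s -> s <= b ->
    s - t < d -> `|phi s - phi t| < e.
Proof.
move=> ac e e0; have [d d0 H] := ac e e0; exists d => // s t at_ ts sb std.
have := H 1%N (fun=> t) (fun=> s); rewrite !big_ord1; apply => //.
by move=> i j _ _ _; rewrite (ord1 i) (ord1 j).
Qed.

Definition itv_family (a b : R) (O : set R) N (u v : 'I_N -> R) :=
  [/\ forall i, a <= u i /\ u i <= v i /\ v i <= b,
      forall i, `]u i, v i[ `<=` O &
      trivIset setT (fun i => `]u i, v i[%classic)].

Lemma itv_family_length a b O N (u v : 'I_N -> R) : measurable O ->
  itv_family a b O u v -> ((\sum_(i < N) (v i - u i))%:E <= mu O)%E.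
Proof.
move=> mO [uv uvO tuv].
have -> : (\sum_(i < N) (v i - u i))%:E = (\sum_(i < N) mu `]u i, v i[)%E.
  rewrite -sumEFin; apply: eq_bigr => i _.
  have [_ [+ _]] := uv i; rewrite lebesgue_measure_itv/= lte_fin.
  rewrite le_eqVlt => /predU1P[->|->]; last by rewrite EFinB.
  by rewrite ltxx subrr.
rewrite -measure_bigsetU_ord//; apply: le_measure; rewrite ?inE//.
- by apply: bigsetU_measurable => i _; exact: measurable_itv.
- by elim/big_ind : _ => // A B AO BO; rewrite subUset.
Qed.

Lemma itv_family_cat a b s t O N (u v : 'I_N -> R) :
  a <= s -> s <= t -> t <= b -> `]s, t[ `<=` O -> itv_family a s O u v ->
  itv_family a b O (fun i => if unlift ord_max i is Some j then u j else s)
                   (fun i => if unlift ord_max i is Some j then v j else t).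
Proof.
move=> as_ st tb stO [uv uvO tuv]; split.
- move=> i; case: unliftP => [j _|_]; last by [].
  by have [? [? ?]] := uv j; do 2?split => //; lra.
- by move=> i; case: unliftP => [j _|_//]; exact: uvO.
- move=> i j _ _.
  have lift_disj l x : x \in `]u l, v l[ -> x \in `]s, t[ -> False.
    by rewrite !in_itv/=; have [_ [_ ?]] := uv l => /andP[? ?] /andP[? ?]; lra.
  case: unliftP => [i' ->|->]; case: unliftP => [j' ->|->] //.
  + by move=> h; congr (lift _ _); exact: tuv h.
  + by move=> [x [/= h1 h2]]; case: (lift_disj i' x).
  + by move=> [x [/= h1 h2]]; case: (lift_disj j' x).
Qed.

Definition varsums (a s : R) (O : set R) (phi : R -> R) : set R :=
  [set z | exists N (u v : 'I_N -> R), itv_family a s O u v /\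
     z = \sum_(i < N) `|phi (v i) - phi (u i)|].

Lemma varsums0 a s O phi : varsums a s O phi 0.
Proof.
exists 0%N, (fun=> a), (fun=> a); rewrite big_ord0; split => //.
by split => -[].
Qed.

(* The total variation of phi inside O serves as a monotone corrector at the
   exceptional points. *)
Lemma ac_growth (a b : R) (phi g : R -> R) (N : set R) : a <= b ->
  real_ac a b phi -> mu.-negligible N ->
  mu.-integrable setT (EFin \o g) -> (forall x, 0 <= g x) ->
  (forall s, a < s -> s < b -> ~ N s ->
     derivable phi s 1 /\ derive1 phi s <= g s) ->
  phi b - phi a <= \int[mu]_(t in `[a, b]) g t.
Proof.
move=> ab ac N0 ig g0 dphi.
have locg : locally_integrable setT g.
  split; [by case/integrableP: ig => /measurable_EFinP|exact: openT|].
  move=> K _ cK; case/integrableP: ig => mg; apply: le_lt_trans.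
  apply: ge0_subset_integral => //; first exact: compact_measurable.
  by do 2 apply: measurableT_comp => //; exact/measurable_EFinP.
pose F y := (\int[mu]_(t in `[a, y]) g t)%R.
have intS A : measurable A -> mu.-integrable A (EFin \o g).
  by move=> mA; apply: (@integrableS _ _ _ _ setT).
have homoF : {in `[a, b] &, {homo F : x y / x <= y}}.
  move=> x y; rewrite !in_itv/= => /andP[ax xb] /andP[ay yb] xy.
  have fin z : (\int[mu]_(t in `[a, z]) (g t)%:E)%E \is a fin_num.
    by apply: integrable_fin_num => //; exact: intS.
  apply: fine_le => //; apply: ge0_subset_integral => //.
    by case/integrableP: (intS _ (measurable_itv `[a, y])).
    by move=> z _; rewrite lee_fin.
  by apply: subset_itvl; rewrite bnd_simp.
have Fa : F a = 0 by rewrite /F set_itv1 Rintegral_set1.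
(* The point [a] counts as exceptional because [dphi] concerns the open interval only; at the other
   points [F] has derivative [g]. *)
pose bad := N `|` [set a] `|` ~` [set x | lebesgue_pt g x].
have /negligible_outer_measure bad0 : mu.-negligible bad.
  apply: negligibleU; last exact: lebesgue_differentiation.
  by apply: negligibleU => //; apply/negligibleP => //; exact: lebesgue_measure_set1.
apply/ler_addgt0Pr => e e0.
have ehalf0 : 0 < e / 2 by rewrite divr_gt0.
have [d d0 acd] := ac _ ehalf0.
have dhalf0 : 0 < d / 2 by rewrite divr_gt0.
have [ O [oO badO muO]] := outer_measure_open_le bad dhalf0.
have {}muO : (mu O < d%:E)%E.
  by apply: (le_lt_trans muO); rewrite bad0 add0e lte_fin; lra.
have mO : measurable O by exact: open_measurable.
have vsum_le s : s <= b -> ubound (varsums a s O phi) (e / 2).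
  move=> sb z [n [u [v [fam ->]]]]; apply/ltW/acd.
  - by case: fam => + _ _ i => /(_ i)[? [? ?]]; do 2?split => //; lra.
  - by case: fam.
  - by rewrite -lte_fin; apply: le_lt_trans muO; exact: itv_family_length fam.
have hsv s : s <= b -> has_sup (varsums a s O phi).
  by move=> sb; split; [exists 0; exact: varsums0|exists (e / 2); exact: vsum_le].
pose V s := sup (varsums a s O phi).
have Vb : V b <= e / 2 by apply: ge_sup; [exists 0; exact: varsums0|exact: vsum_le].
have V0 s : s <= b -> 0 <= V s.
  by move=> sb; apply: (sup_upper_bound (hsv _ sb)); exact: varsums0.
have Vhomo s t : s <= t -> t <= b -> V s <= V t.
  move=> st tb; apply: ge_sup; first by exists 0; exact: varsums0.
  move=> z [n [u [v [[uv uvO tuv] ->]]]]; apply: (sup_upper_bound (hsv _ tb)).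
  exists n, u, v; split => //; split => // i.
  by have [? [? ?]] := uv i; do 2?split => //; lra.
have Vjump s t : a <= s -> s <= t -> t <= b -> `]s, t[ `<=` O ->
    V s + `|phi t - phi s| <= V t.
  move=> as_ st tb stO; rewrite -lerBrDr; apply: ge_sup.
    by exists 0; exact: varsums0.
  move=> z [n [u [v [fam ->]]]]; rewrite lerBrDr.
  apply: (sup_upper_bound (hsv _ tb)).
  exists n.+1, (fun i => if unlift ord_max i is Some j then u j else s),
    (fun i => if unlift ord_max i is Some j then v j else t).
  split; first exact: itv_family_cat fam.
  rewrite big_ord_recr/=; congr (_ + _); last by rewrite unlift_none.
  apply: eq_bigr => i _; have -> : widen_ord (leqnSn n) i = lift ord_max i.
    by apply/val_inj; rewrite /= /bump leqNgt ltn_ord.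
  by rewrite liftK.
pose eta := e / 2 / (b - a + 1).
have eta0 : 0 < eta by rewrite divr_gt0//; lra.
have etaE : eta * (b - a) <= e / 2.
  by rewrite /eta mulrAC ler_pdivrMr; [nra|lra].
(* Near a bad point [V] pays for the increment of [phi], since a neighbourhood lies in [O]; at a
   good point [F] pays, and the slope [eta] absorbs the error of the difference quotient. [V] and
   [eta] contribute at most [e / 2] each. *)
pose G s := F s + V s + eta * s.
have : phi b - phi a <= G b - G a.
  apply: right_growth_le => //.
  - move=> x y xab yab xy; rewrite /G.
    have := homoF _ _ xab yab xy.
    have := Vhomo x y xy; move: xab yab; rewrite !in_itv/= => /andP[? ?] /andP[? ?].
    by move=> /(_ ltac:(lra)) => ? ?; nra.
  - move=> s as_ sb e' e'0; have [d' d'0 H] := real_ac_cont ac e'0.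
    by exists d' => // t at_ ts std; apply: H.
  - move=> s as_ sb; have [sbad|sgood] := pselect (bad s).
      have Os : nbhs s O by apply: open_nbhs_nbhs; split => //; exact: badO.
      case: Os => r /= r0 sO; exists r => // t st tb tsr.
      have stO : `]s, t[ `<=` O.
        move=> x /=; rewrite in_itv/= => /andP[sx xt]; apply: sO.
        by rewrite /= ltr_distl; apply/andP; split; lra.
      have := Vjump _ _ as_ st tb stO; have := ler_norm (phi t - phi s).
      have : F s <= F t by apply: homoF => //; rewrite in_itv/=; apply/andP; split; lra.
      rewrite /G; nra.
    have [sN [sa sleb]] : ~ N s /\ s <> a /\ lebesgue_pt g s.
      split; first by move=> ?; apply: sgood; left; left.
      split; first by move=> ?; apply: sgood; left; right.
      by apply: contrapT => ?; apply: sgood; right.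
    have {}as_ : a < s by rewrite lt_neqAle as_ andbT; apply/eqP => ?; exact/sa.
    have [dphis phi's] := dphi _ as_ sb sN.
    have as_' : (BLeft a < BRight s)%E by rewrite lte_fin.
    have [dFs F's] := FTC1_lebesgue_pt sb (intS _ (measurable_itv _)) as_' sleb.
    pose H t := F t - phi t.
    have dH : is_derive s 1 H ('D_1 F s - 'D_1 phi s).
      by apply: is_deriveB; apply/derivableP.
    have H's : - eta < 'D_1 H s.
      by rewrite derive_val -!derive1E F's; lra.
    have : h^-1 *: (H (h *: 1 + s) - H s) @[h --> 0^'] --> 'D_1 H s.
      by have := @ex_derive _ _ _ _ _ _ _ dH => /cvg_ex [l Hl]; rewrite /derive (cvg_lim _ Hl).
    move=> /cvgrPdist_lt /(_ ('D_1 H s + eta)) /= [|r r0 Hr]; first lra.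
    exists r => // t st tb tsr; have [->|tns] := eqVneq t s; first by rewrite !subrr.
    have {}st : s < t by rewrite lt_neqAle eq_sym tns.
    have := Hr (t - s); rewrite /= sub0r normrN gtr0_norm ?subr_gt0// => /(_ tsr).
    rewrite subr_eq0 tns => /(_ isT); rewrite [_ *: 1]mulr1 subrK ltr_norml => /andP[_].
    rewrite ltrBlDr -ltrBlDl => Hlow.
    have {}Hlow : - eta < (t - s)^-1 * (H t - H s) by move: Hlow; rewrite -/(_ *: _); lra.
    rewrite mulrC ltr_pdivlMr ?subr_gt0// in Hlow.
    have := Vhomo s t (ltW st) tb; rewrite /G; move: Hlow; rewrite /H; lra.
rewrite /G -/(F b) Fa; have := V0 a ab; lra.
Qed.
End Growth.

(** * Lower bounds for the Carnot-Caratheodory distance *)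

Section DccLower.
Context {R : realType} {n : nat}.
Notation mu := (@lebesgue_measure R).
Notation heisn := (heis R n).
Implicit Types (p q v w : heisn) (gamma : R -> heisn).

Definition omega (u v : 'rV[R]_n * 'rV[R]_n) : R :=
  \sum_(j < n) (u.1 ord0 j * v.2 ord0 j - u.2 ord0 j * v.1 ord0 j).

Section Omega.
Implicit Types (a b c : 'rV[R]_n * 'rV[R]_n).

Lemma omegaC a b : omega a b = - omega b a.
Proof. by rewrite -sumrN; apply: eq_bigr => j _; ring. Qed.

Lemma omegaDr a b c : omega a (b + c) = omega a b + omega a c.
Proof. by rewrite -big_split; apply: eq_bigr => j _; rewrite /= !mxE; ring. Qed.

Lemma omegaZr a x b : omega a (x *: b) = x * omega a b.
Proof. by rewrite mulr_sumr; apply: eq_bigr => j _; rewrite /= !mxE; ring. Qed.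

Lemma omegaDl a b c : omega (a + b) c = omega a c + omega b c.
Proof. by rewrite omegaC omegaDr opprD -!omegaC. Qed.

Lemma omegaZl a x b : omega (x *: a) b = x * omega a b.
Proof. by rewrite omegaC omegaZr -mulrN -omegaC. Qed.

Lemma omegaNr a b : omega a (- b) = - omega a b.
Proof. by rewrite -scaleN1r omegaZr mulN1r. Qed.

Lemma omegaNl a b : omega (- a) b = - omega a b.
Proof. by rewrite -scaleN1r omegaZl mulN1r. Qed.

Lemma omegaaa a : omega a a = 0.
Proof. by apply: big1 => j _; ring. Qed.
End Omega.

(** The t-coordinate of the group element p^-1 * q; its horizontal part is [q.1 - p.1]. *)
Definition tau p q : R := q.2 - p.2 + 2 * omega p.1 q.1.

(** Linear forms with an explicit bound carry derivability and absolute continuity from curves to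
    real functions, to which [ac_growth] applies. *)
Definition bounded_functional (l : heisn -> R) (B : R) :=
  [/\ forall u v, l (u + v) = l u + l v, forall c u, l (c *: u) = c * l u &
      forall u, `|l u| <= B * `|u| ].

Lemma bfB l B u v : bounded_functional l B -> l (u - v) = l u - l v.
Proof. by move=> [lD lZ _]; rewrite -scaleN1r lD lZ mulN1r. Qed.

Lemma bf_derive l B gamma s : bounded_functional l B -> derivable gamma s 1 ->
  derivable (l \o gamma) s 1 /\ derive1 (l \o gamma) s = l (derive1 gamma s).
Proof.
move=> bl dg; have [lD lZ lB] := bl.
have B0 : 0 < `|B| + 1 by rewrite ltr_wpDl.
suff H : h^-1 *: ((l \o gamma) (h *: 1 + s) - (l \o gamma) s) @[h --> 0^'] -->
    l (derive1 gamma s).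
  split; first by apply/cvg_ex; exists (l (derive1 gamma s)).
  by rewrite derive1E /derive; apply/cvg_lim.
have : h^-1 *: (gamma (h *: 1 + s) - gamma s) @[h --> 0^'] --> derive1 gamma s.
  by rewrite derive1E; exact: dg.
move=> /cvgrPdist_lt H; apply/cvgrPdist_lt => e e0.
have : 0 < e / (`|B| + 1) by rewrite divr_gt0.
move=> /H; apply: filterS => h.
rewrite ltr_pdivlMr// => hB /=.
have -> : h^-1 *: (l (gamma (h *: 1 + s)) - l (gamma s)) =
          l (h^-1 *: (gamma (h *: 1 + s) - gamma s)).
  by rewrite lZ (bfB _ _ bl).
rewrite -(bfB _ _ bl) (le_lt_trans (lB _))//; apply: le_lt_trans hB.
rewrite mulrC ler_wpM2l//.
by have := ler_norm B; lra.
Qed.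

Lemma bf_ac l B gamma a b : bounded_functional l B ->
  absolutely_continuous_on a b gamma -> real_ac a b (l \o gamma).
Proof.
move=> bl ac e e0; have [_ _ lB] := bl.
have B0 : 0 < `|B| + 1 by rewrite ltr_wpDl.
have [d d0 H] := ac (e / (`|B| + 1)) (divr_gt0 e0 B0).
exists d => // N u v uv tuv uvd; have := H N u v uv tuv uvd.
rewrite ltr_pdivlMr// mulr_suml; apply: le_lt_trans; apply: ler_sum => i _ /=.
rewrite -(bfB _ _ bl) (le_trans (lB _))// mulrC ler_wpM2l//.
by have := ler_norm B; lra.
Qed.

(** The derivative is a pointwise limit of difference quotients of a continuous function. As [phi]
    is controlled only on the interval, it is composed with the clamping map [cl]; inside the open
    interval the quotients with step 1/(m+1) eventually do not see the clamp. *)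
Lemma measurable_derive1 (a b : R) (phi : R -> R) (D : set R) :
  real_ac a b phi -> measurable D -> D `<=` `]a, b[ ->
  (forall s, D s -> derivable phi s 1) -> measurable_fun D (derive1 phi).
Proof.
move=> ac mD Dab dphi.
have [ab|ba] := ltP a b; last first.
  have -> : D = set0.
    apply/seteqP; split => // x /Dab /=; rewrite in_itv/= => /andP[? ?]; lra.
  exact: measurable_fun_set0.
pose cl s := Num.max a (Num.min b s).
have cl_in s : a <= cl s /\ cl s <= b.
  by rewrite /cl le_max lexx ge_max ge_min lexx (ltW ab).
have cl_id s : a <= s -> s <= b -> cl s = s.
  by move=> as_ sb; rewrite /cl min_r// max_r.
have cl_lip s t : s <= t -> cl s <= cl t /\ cl t - cl s <= t - s.
  by move=> st; rewrite /cl; split;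
    case: (leP b s) => ?; case: (leP b t) => ?; case: (leP a b) => ?;
    case: (leP a s) => ?; case: (leP a t) => ?; lra.
have cphi : continuous (phi \o cl).
  move=> s; apply/cvgrPdist_lt => e e0.
  have [d d0 H] := real_ac_cont ac e0.
  exists d => // t; rewrite /= => std.
  have [st|/ltW ts] := leP s t.
    have [h1 h2] := cl_lip _ _ st; rewrite distrC; apply: H => //;
      [by case: (cl_in s)|by case: (cl_in t)|].
    by move: std; rewrite distrC ger0_norm ?subr_ge0//; lra.
  have [h1 h2] := cl_lip _ _ ts; apply: H => //;
    [by case: (cl_in t)|by case: (cl_in s)|].
  by move: std; rewrite ger0_norm ?subr_ge0//; lra.
pose h (m : nat) s := m.+1%:R * ((phi \o cl) (s + m.+1%:R^-1) - (phi \o cl) s).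
apply: (@measurable_fun_cvg _ _ _ D h).
  move=> m; apply: measurable_funTS; apply: continuous_measurable_fun => s.
  apply: cvgM; first exact: cvg_cst.
  apply: cvgB; last exact: cphi.
  apply: (@cvg_comp _ _ _ (+%R^~ m.+1%:R^-1) (phi \o cl) _ _ _ _ (cphi _)).
  by apply: (@cvgD _ _ _ _ _ id (cst _)); [exact: cvg_id|exact: cvg_cst].
move=> s Ds; have := Dab _ Ds; rewrite /= in_itv/= => /andP[as_ sb].
have : h^-1 *: (phi (h *: 1 + s) - phi s) @[h --> 0^'] --> derive1 phi s.
  by rewrite derive1E; exact: dphi.
move=> /cvgrPdist_lt H; apply/cvgrPdist_lt => e e0.
have [r r0 Hr] := H _ e0.
have bs : 0 < b - s by lra.
near=> m.
have mr : m.+1%:R^-1 < r :> R.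
  by near: m; exact: near_infty_natSinv_lt (PosNum r0).
have ms : m.+1%:R^-1 < b - s :> R.
  by near: m; exact: near_infty_natSinv_lt (PosNum bs).
have m0 : 0 < m.+1%:R^-1 :> R by rewrite invr_gt0.
have := Hr m.+1%:R^-1; rewrite /= sub0r normrN gtr0_norm// gt_eqF//.
move=> /(_ mr isT); rewrite [_ *: 1]mulr1 invrK.
rewrite /h /= (cl_id s) ?ltW// (cl_id (s + _)); last first.
- by rewrite -lerBrDl ltW.
- by rewrite (le_trans (ltW as_))// lerDl ltW.
by rewrite [s + _]addrC.
Unshelve. all: by end_near. Qed.

Lemma bf_hx j : bounded_functional (fun v => hx v ord0 j) 1.
Proof.
split=> [u v|c u|u]; rewrite ?mxE// mul1r prod_normE le_max; apply/orP; left.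
rewrite prod_normE le_max; apply/orP; left.
by rewrite [leRHS]/Num.norm/= mx_normrE; apply: (le_bigmax _ _ (ord0, j)).
Qed.

Lemma bf_hy j : bounded_functional (fun v => hy v ord0 j) 1.
Proof.
split=> [u v|c u|u]; rewrite ?mxE// mul1r prod_normE le_max; apply/orP; left.
rewrite prod_normE le_max; apply/orP; right.
by rewrite [leRHS]/Num.norm/= mx_normrE; apply: (le_bigmax _ _ (ord0, j)).
Qed.

Lemma hnorm_ge0 v : 0 <= hnorm v. Proof. exact: sqrtr_ge0. Qed.

Lemma coord_le_hnorm v j :
  `|hx v ord0 j| <= hnorm v /\ `|hy v ord0 j| <= hnorm v.
Proof.
have sq : hx v ord0 j ^+ 2 + hy v ord0 j ^+ 2 <= hdot v v.
  rewrite /hdot (bigD1 j)//= -!expr2 lerDl sumr_ge0// => i _.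
  by rewrite -!expr2 addr_ge0// sqr_ge0.
by split; rewrite -sqrtr_sqr ler_wsqrtr//; apply: le_trans sq;
  rewrite ?lerDl ?lerDr sqr_ge0.
Qed.

(** Integrated form of a bound of [l] on the velocity by [K] times its norm; it is stated up to an
    intermediate time [c], so that it can also bound positions along the curve. *)
Lemma curve_growth l B K L gamma (a b c : R) : bounded_functional l B ->
  0 <= K -> horizontal_curve a b gamma -> a <= c -> c <= b ->
  (cc_length a b gamma <= L%:E)%E ->
  (forall s, a < s -> s < c -> derivable gamma s 1 ->
     horizontal_space (gamma s) (derive1 gamma s) ->
     l (derive1 gamma s) <= K * hnorm (derive1 gamma s)) ->
  l (gamma c) - l (gamma a) <= K * L.
Proof.
move=> bl K0 [ac [N [mN N0 badN]]] ac_ cb lenL lK.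
pose D := `]a, b[ `\` N.
have mD : measurable D by apply: measurableD => //; exact: measurable_itv.
have goodD s : a < s -> s < b -> ~ N s ->
    derivable gamma s 1 /\ horizontal_space (gamma s) (derive1 gamma s).
  move=> as_ sb Ns; apply: contrapT => H; apply: Ns; apply: badN => /= H'.
  by apply: H; apply: H'; rewrite in_itv/= !ltW.
have coordE l' B' : bounded_functional l' B' ->
    measurable_fun D (fun s => l' (derive1 gamma s)).
  move=> bl'; apply: (@eq_measurable_fun _ _ _ _ _ (derive1 (l' \o gamma))).
    move=> s; rewrite inE => -[]/=; rewrite in_itv/= => /andP[as_ sb] Ns.
    by have [dg _] := goodD _ as_ sb Ns; have [_ ->] := bf_derive bl' dg.
  apply: (@measurable_derive1 a b) => //; first exact: bf_ac bl' ac.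
    by move=> s [].
  move=> s []/=; rewrite in_itv/= => /andP[as_ sb] Ns.
  by have [dg _] := goodD _ as_ sb Ns; have [] := bf_derive bl' dg.
(* Off [D] the derivative may be a default value. Cutting the speed off there makes it measurable
   and can only decrease its integral. *)
pose g := (fun s => hnorm (derive1 gamma s)) \_ D.
have g0 s : 0 <= g s by rewrite /g patchE; case: ifP => // _; exact: hnorm_ge0.
have mhnorm : measurable_fun D (fun s => hnorm (derive1 gamma s)).
  have mh : measurable_fun D (fun s => hdot (derive1 gamma s) (derive1 gamma s)).
    apply: measurable_sum => j; apply: measurable_funD; apply: measurable_funM;
    solve [exact: (coordE _ _ (bf_hx j)) | exact: (coordE _ _ (bf_hy j))].
  exact: (measurableT_comp (continuous_measurable_fun (@sqrt_continuous R)) mh).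
have mg := (measurable_restrictT _ mD).1 mhnorm.
have gL : (\int[mu]_(s in setT) (g s)%:E <= L%:E)%E.
  apply: le_trans lenL.
  rewrite (_ : (fun s => (g s)%:E) = (fun s => (hnorm (derive1 gamma s))%:E) \_ D).
    rewrite -integral_mkcond; apply: le_ge0_integral => x.
    - by rewrite lee_fin hnorm_ge0.
    - by rewrite lee_fin hnorm_ge0.
    - by move=> -[]; rewrite /= !in_itv/= => /andP[/ltW -> /ltW ->].
  by apply/funext => x; rewrite /g !patchE; case: ifP.
have ig : mu.-integrable setT (EFin \o g).
  apply/integrableP; split; first exact/measurable_EFinP.
  apply: le_lt_trans (ltry L); apply: le_trans gL; rewrite le_eqVlt; apply/orP; left.
  by apply/eqP; apply: eq_integral => x _ /=; rewrite ger0_norm.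
have acc : real_ac a c (l \o gamma).
  move=> e e0; have [d d0 H] := bf_ac bl ac e0; exists d => // M u v uv.
  by apply: H => i; have [? [? ?]] := uv i; do 2?split => //; lra.
have Kg x : 0 <= K * g x by rewrite mulr_ge0.
have iKg : mu.-integrable setT (EFin \o (fun s => K * g s)).
  rewrite (_ : _ \o _ = (fun s => K%:E * (g s)%:E)%E).
    exact: integrableZl.
  by apply/funext => s /=; rewrite EFinM.
have negN : mu.-negligible N by exists N; split.
apply: (le_trans (ac_growth ac_ acc negN iKg Kg _)).
  move=> s as_ sc Ns; have sb : s < b by lra.
  have [dg hg] := goodD s as_ sb Ns.
  have [dlg ->] := bf_derive bl dg; split=> //.
  rewrite /g patchE mem_set; first exact: lK.
  by split => //=; rewrite in_itv/= as_ sb.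
have intg : \int[mu]_(t in `[a, c]) g t <= L.
  have fin : (\int[mu]_(t in `[a, c]) (g t)%:E)%E \is a fin_num.
    by apply: integrable_fin_num => //; apply: (@integrableS _ _ _ _ setT).
  rewrite -lee_fin /Rintegral fineK//; apply: le_trans gL.
  apply: ge0_subset_integral => //; first exact/measurable_EFinP.
  by move=> x _; rewrite lee_fin.
rewrite RintegralZl//; last by apply: (@integrableS _ _ _ _ setT).
by rewrite ler_wpM2l.
Qed.

(** Horizontal vectors lie in the kernel of the contact form dt - 2 sum (y dx - x dy). *)
Lemma horizontal_t p v : horizontal_space p v ->
  v.2 = 2 * \sum_(j < n) (hy p ord0 j * hx v ord0 j - hx p ord0 j * hy v ord0 j).
Proof.
move=> [a [b ->]].
have snd_sum (F : 'I_n -> heisn) : (\sum_i F i).2 = \sum_i (F i).2.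
  exact: (@big_morph _ _ snd _ _ _ _ (fun u v => erefl (u + v).2) erefl).
rewrite {1}/hcomb snd_sum mulr_sumr; apply: eq_bigr => j _ /=.
have [-> ->] := hcombE p a b j.
by rewrite /GRing.scale/=; ring.
Qed.

Lemma omega_le (u v : 'rV[R]_n * 'rV[R]_n) : `|omega u v| <= 2 * n%:R * `|u| * `|v|.
Proof.
have coord (w : 'rV[R]_n * 'rV[R]_n) j : `|w.1 ord0 j| <= `|w| /\ `|w.2 ord0 j| <= `|w|.
  by split; rewrite prod_normE le_max; apply/orP; [left|right];
    rewrite [leRHS]/Num.norm/= mx_normrE; apply: (le_bigmax _ _ (ord0, j)).
apply: (le_trans (ler_norm_sum _ _ _)).
have -> : 2 * n%:R * `|u| * `|v| = \sum_(j < n) (2 * (`|u| * `|v|)).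
  by rewrite sumr_const card_ord -[RHS]mulr_natl; ring.
apply: ler_sum => j _; apply: (le_trans (ler_normB _ _)); rewrite !normrM.
have [u1 u2] := coord u j; have [v1 v2] := coord v j.
have := ler_pM (normr_ge0 _) (normr_ge0 _) u1 v2.
have := ler_pM (normr_ge0 _) (normr_ge0 _) u2 v1.
lra.
Qed.

Lemma dcc_ltP p q (r : R) : (dcc p q < r%:E)%E ->
  exists a b gamma L, [/\ a <= b, horizontal_curve a b gamma, gamma a = p, gamma b = q &
    (cc_length a b gamma <= L%:E)%E /\ 0 <= L /\ L <= r].
Proof.
move=> /ereal_inf_lt [_ [a [b [gamma [ab hg ga gb ->]]]] len].
have r0 : (0 <= cc_length a b gamma)%E.
  by apply: integral_ge0 => x _; rewrite lee_fin hnorm_ge0.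
exists a, b, gamma, r; split => //; split; first exact: ltW.
split => //; by rewrite -lee_fin (le_trans r0)// ltW.
Qed.

Lemma curve_z_le a b c gamma L : horizontal_curve a b gamma -> a <= c -> c <= b ->
  (cc_length a b gamma <= L%:E)%E -> 0 <= L -> `|(gamma c).1 - (gamma a).1| <= L.
Proof.
move=> hg ac_ cb len L0.
have bfN l B : bounded_functional l B -> bounded_functional (fun v => - l v) B.
  move=> [lD lZ lB]; split=> [u v|k u|u]; rewrite ?normrN//.
    by rewrite lD opprD.
  by rewrite lZ mulrN.
have key l : bounded_functional l 1 -> (forall v, `|l v| <= hnorm v) ->
    `|l (gamma c) - l (gamma a)| <= L.
  move=> bl lle.
  have growth l' : bounded_functional l' 1 -> (forall v, l' v <= hnorm v) ->
      l' (gamma c) - l' (gamma a) <= L.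
    move=> bl' lle'; rewrite -[leRHS]mul1r.
    by apply: (curve_growth bl' _ hg ac_ cb len) => // s _ _ _ _; rewrite mul1r.
  rewrite ler_norml; apply/andP; split.
    have := growth _ (bfN _ _ bl) (fun v => le_trans (ler_norm _) _).
    by move=> /(_ (fun v => ltac:(rewrite normrN; exact: lle))); lra.
  by apply: growth => // v; apply: le_trans (lle v); exact: ler_norm.
rewrite prod_normE ge_max; apply/andP; split; rewrite [leLHS]/Num.norm/= mx_normrE;
  apply: bigmax_le => // -[i j] _ /=; rewrite !mxE (ord1 i).
  by apply: (key _ (bf_hx j)) => v; have [] := coord_le_hnorm v j.
by apply: (key _ (bf_hy j)) => v; have [] := coord_le_hnorm v j.
Qed.

Lemma dcc_z_le p q r : (dcc p q < r%:E)%E -> `|q.1 - p.1| <= r.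
Proof.
move=> /dcc_ltP[a [b [gamma [L [ab hg <- <- [len [L0 Lr]]]]]]].
by apply: le_trans Lr; exact: curve_z_le len L0.
Qed.

(* In the frame translated to p, the vertical speed is twice the symplectic
   product of position and velocity, and the position stays within r. *)
Lemma dcc_tau_le p q r : (dcc p q < r%:E)%E -> `|tau p q| <= 4 * n%:R * r ^+ 2.
Proof.
move=> /dcc_ltP[a [b [gamma [L [ab hg ga gb [len [L0 Lr]]]]]]].
(* The vertical coordinate in the frame translated to [p]; the factor [s] is a sign, so that one
   growth estimate yields both bounds on [tau]. *)
pose l s v := s * (v.2 + 2 * omega p.1 v.1).
have bfl s : `|s| = 1 -> bounded_functional (l s) (1 + 4 * n%:R * `|p.1|).
  move=> s1; split=> [u v|k u|u]; rewrite /l.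
  - by rewrite omegaDr /=; ring.
  - rewrite (_ : (k *: u).1 = k *: u.1)// (_ : (k *: u).2 = k * u.2)// omegaZr.
    by ring.
  - rewrite normrM s1 mul1r (le_trans (ler_normD _ _))// normrM ger0_norm//.
    have u1 : `|u.1| <= `|u| by rewrite [leRHS]prod_normE le_max lexx.
    have u2 : `|u.2| <= `|u| by rewrite [leRHS]prod_normE le_max lexx orbT.
    have := omega_le p.1 u.1.
    have : n%:R * `|p.1| * `|u.1| <= n%:R * `|p.1| * `|u| by rewrite ler_wpM2l ?mulr_ge0.
    lra.
have tauE : tau p q = (l 1 q - l 1 p).
  by rewrite /l omegaaa /tau; ring.
have key s : `|s| = 1 -> s * tau p q <= 4 * n%:R * L ^+ 2.
  move=> s1; have -> : s * tau p q = l s (gamma b) - l s (gamma a).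
    by rewrite tauE ga gb /l; ring.
  (* The vertical speed is at most 4 n L times the norm of the velocity: twice a sum over n planes
     of two products of a displacement at most L with a velocity component. *)
  have -> : 4 * n%:R * L ^+ 2 = (4 * n%:R * L) * L by ring.
  apply: (curve_growth (bfl s s1) _ hg ab (lexx b) len); first by rewrite !mulr_ge0.
  move=> c ac_ cb dg hor.
  have zc := curve_z_le hg (ltW ac_) (ltW cb) len L0.
  rewrite /l (horizontal_t hor) -mulrDr.
  set v := derive1 gamma c.
  have -> : \sum_(j < n) (hy (gamma c) ord0 j * hx v ord0 j -
      hx (gamma c) ord0 j * hy v ord0 j) + omega p.1 v.1 =
      - \sum_(j < n) ((hx (gamma c) ord0 j - hx p ord0 j) * hy v ord0 j -
                     (hy (gamma c) ord0 j - hy p ord0 j) * hx v ord0 j).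
    rewrite /omega -sumrN -big_split/=; apply: eq_bigr => j _.
    by rewrite /hx /hy; ring.
  apply: (le_trans (ler_norm _)); rewrite !normrM s1 mul1r normrN ger0_norm//.
  have : `|\sum_(j < n) ((hx (gamma c) ord0 j - hx p ord0 j) * hy v ord0 j -
     (hy (gamma c) ord0 j - hy p ord0 j) * hx v ord0 j)| <= \sum_(j < n) (2 * (L * hnorm v)).
    apply: (le_trans (ler_norm_sum _ _ _)); apply: ler_sum => j _.
    apply: (le_trans (ler_normB _ _)); rewrite !normrM.
    have [v1 v2] := coord_le_hnorm v j.
    have [_ _ /(_ (gamma c - gamma a))] := bf_hx j; rewrite mul1r => _.
    have c1 : `|hx (gamma c) ord0 j - hx p ord0 j| <= L.
      apply: le_trans zc; rewrite -ga prod_normE le_max; apply/orP; left.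
      rewrite [leRHS]/Num.norm/= mx_normrE; apply: le_trans (le_bigmax _ _ (ord0, j)).
      by rewrite /= !mxE.
    have c2 : `|hy (gamma c) ord0 j - hy p ord0 j| <= L.
      apply: le_trans zc; rewrite -ga prod_normE le_max; apply/orP; right.
      rewrite [leRHS]/Num.norm/= mx_normrE; apply: le_trans (le_bigmax _ _ (ord0, j)).
      by rewrite /= !mxE.
    have := ler_pM (normr_ge0 _) (normr_ge0 _) c1 v2.
    have := ler_pM (normr_ge0 _) (normr_ge0 _) c2 v1.
    lra.
  by rewrite sumr_const card_ord -mulr_natl; lra.
have L2 : 4 * n%:R * L ^+ 2 <= 4 * n%:R * r ^+ 2.
  by rewrite ler_wpM2l ?mulr_ge0// lerXn2r ?nnegrE// (le_trans L0).
apply: le_trans L2; rewrite ler_norml; apply/andP; split.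
  by have := key (-1); rewrite normrN1 => /(_ erefl); lra.
by have := key 1; rewrite normr1 => /(_ erefl); lra.
Qed.
End DccLower.

(** * Upper bound for the Carnot-Caratheodory distance *)

Section DccUpper.
Context {R : realType} {n : nat}.
Notation mu := (@lebesgue_measure R).
Notation heisn := (heis R n).
Implicit Types (p q v w : heisn).

Lemma poly_lipschitz (P : {poly R}) : exists2 C, 0 <= C &
  forall s t, 0 <= s <= 1 -> 0 <= t <= 1 -> `|P.[s] - P.[t]| <= C * `|s - t|.
Proof.
elim/poly_ind: P => [|P c [C C0 IH]].
  by exists 0 => // s t _ _; rewrite !horner0 subrr normr0 mul0r.
exists (C + `|P.[0]| + C); first by rewrite !addr_ge0.
move=> s t s01 t01; rewrite !hornerE.
have -> : P.[s] * s + c - (P.[t] * t + c) = (P.[s] - P.[t]) * s + P.[t] * (s - t) by ring.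
apply: (le_trans (ler_normD _ _)); rewrite !normrM.
have h1 := IH s t s01 t01.
have h2 := IH t 0 t01 ltac:(by rewrite lexx ler01).
have /andP[s0 s1] := s01; have /andP[t0 t1] := t01.
rewrite subr0 (ger0_norm s0) in h2 *.
rewrite (ger0_norm t0) in h2.
have h3 : `|P.[t]| <= C + `|P.[0]|.
  by have := ler_normD (P.[t] - P.[0]) P.[0]; rewrite subrK; nra.
have := ler_wpM2r (normr_ge0 (s - t)) h3.
have := normr_ge0 (P.[s] - P.[t]); have := normr_ge0 (s - t).
nra.
Qed.

Definition poly_curve (X Y : 'I_n -> {poly R}) (T : {poly R}) (s : R) : heisn :=
  (\row_j (X j).[s], \row_j (Y j).[s], T.[s]).

Lemma poly_curve_derive X Y T s :
  derivable (poly_curve X Y T) s 1 /\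
  derive1 (poly_curve X Y T) s =
    poly_curve (fun j => (X j)^`()) (fun j => (Y j)^`()) T^`() s.
Proof.
have row (Z : 'I_n -> {poly R}) :
    h^-1 *: ((\row_j (Z j).[h *: 1 + s] : 'rV[R]_n) - \row_j (Z j).[s])
      @[h --> 0^'] --> (\row_j (Z j)^`().[s] : 'rV[R]_n).
  have dZ : derivable (fun s => \row_j (Z j).[s] : 'rV[R]_n) s 1.
    apply/derivable_mxP => i j.
    have -> : (fun x => (\row_j (Z j).[x] : 'rV[R]_n) i j) = horner (Z j).
      by apply/funext => x; rewrite mxE.
    exact: derivable_horner.
  have dE : 'D_1 (fun s => \row_j (Z j).[s] : 'rV[R]_n) s = \row_j (Z j)^`().[s].
    rewrite derive_mx//; apply/rowP => j; rewrite !mxE.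
    have -> : (fun x => (\row_j (Z j).[x] : 'rV[R]_n) ord0 j) = horner (Z j).
      by apply/funext => x; rewrite mxE.
    by rewrite derive_val.
  by rewrite -dE; exact: dZ.
suff H : h^-1 *: (poly_curve X Y T (h *: 1 + s) - poly_curve X Y T s) @[h --> 0^'] -->
    poly_curve (fun j => (X j)^`()) (fun j => (Y j)^`()) T^`() s.
  split; first by apply/cvg_ex; eexists; exact: H.
  by rewrite derive1E /derive; apply/cvg_lim.
have dT : h^-1 *: (T.[h *: 1 + s] - T.[s]) @[h --> 0^'] --> T^`().[s].
  by have [dT <-] := is_derive_poly T s; exact: dT.
exact: (cvg_pair (cvg_pair (row X) (row Y)) dT).
Qed.

Lemma poly_curve_ac X Y T : absolutely_continuous_on 0 1 (poly_curve X Y T).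
Proof.
have rowlip (Z : 'I_n -> {poly R}) : exists2 C, 0 <= C &
    forall s t, 0 <= s <= 1 -> 0 <= t <= 1 ->
    `|(\row_j (Z j).[s] : 'rV[R]_n) - \row_j (Z j).[t]| <= C * `|s - t|.
  have /choice [C HC] j : exists C, 0 <= C /\
      forall s t, 0 <= s <= 1 -> 0 <= t <= 1 -> `|(Z j).[s] - (Z j).[t]| <= C * `|s - t|.
    by have [C ? ?] := poly_lipschitz (Z j); exists C.
  exists (\sum_j C j); first by apply: sumr_ge0 => j _; case: (HC j).
  move=> s t s01 t01; rewrite [leLHS]/Num.norm/= mx_normrE.
  apply: bigmax_le => [|[i j] _ /=].
    by rewrite mulr_ge0// sumr_ge0// => j _; case: (HC j).
  rewrite !mxE; have [_ Hj] := HC j; apply: (le_trans (Hj _ _ s01 t01)).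
  rewrite ler_wpM2r// (bigD1 j)//= lerDl sumr_ge0// => l _; by case: (HC l).
have [C1 C10 H1] := rowlip X; have [C2 C20 H2] := rowlip Y.
have [C3 C30 H3] := poly_lipschitz T.
pose C := C1 + C2 + C3 + 1.
have C0 : 0 < C by rewrite /C; lra.
move=> e e0; exists (e / C); first by rewrite divr_gt0.
move=> N u v uv _; rewrite ltr_pdivlMr// mulrC; apply: le_lt_trans.
rewrite mulr_sumr; apply: ler_sum => i _.
have [u0 [uvi v1]] := uv i.
have u01 : 0 <= u i <= 1 by apply/andP; split; lra.
have v01 : 0 <= v i <= 1 by apply/andP; split; lra.
have d0 : 0 <= v i - u i by lra.
have h1 := H1 _ _ v01 u01; have h2 := H2 _ _ v01 u01; have h3 := H3 _ _ v01 u01.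
rewrite ger0_norm// in h1 h2 h3.
rewrite prod_normE ge_max; apply/andP; split; last by apply: (le_trans h3); rewrite /C; nra.
rewrite prod_normE ge_max; apply/andP; split;
  [apply: (le_trans h1)|apply: (le_trans h2)]; rewrite /C; nra.
Qed.

Lemma poly_curve_horizontal X Y T :
  (forall s, T^`().[s] = 2 * \sum_j ((Y j).[s] * (X j)^`().[s] - (X j).[s] * (Y j)^`().[s])) ->
  horizontal_curve 0 1 (poly_curve X Y T).
Proof.
move=> HT; split; first exact: poly_curve_ac.
apply/aeW => s _; have [dg ->] := poly_curve_derive X Y T s; split => //.
exists (fun j => (X j)^`().[s]), (fun j => (Y j)^`().[s]).
set v := hcomb _ _ _.
have v2 : v.2 = T^`().[s].
  rewrite (@horizontal_t _ _ (poly_curve X Y T s)); last by eexists; eexists.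
  rewrite HT; congr (_ * _); apply: eq_bigr => j _.
  have [-> ->] := hcombE (poly_curve X Y T s) (fun j => (X j)^`().[s]) (fun j => (Y j)^`().[s]) j.
  by rewrite /hx /hy /= !mxE.
rewrite [v]surjective_pairing v2 [v.1]surjective_pairing; congr (_, _, _).
- apply/rowP => j; rewrite mxE.
  by have [<- _] := hcombE (poly_curve X Y T s) (fun j => (X j)^`().[s]) (fun j => (Y j)^`().[s]) j.
- apply/rowP => j; rewrite mxE.
  by have [_ <-] := hcombE (poly_curve X Y T s) (fun j => (X j)^`().[s]) (fun j => (Y j)^`().[s]) j.
Qed.

Lemma hnorm_le_sum v : hnorm v <= \sum_j (`|hx v ord0 j| + `|hy v ord0 j|).
Proof.
set S := \sum_j _.
have S0 : 0 <= S by apply: sumr_ge0 => j _; rewrite addr_ge0.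
rewrite -(ger0_norm S0) -sqrtr_sqr ler_wsqrtr// /hdot expr2 {1}/S mulr_suml.
apply: ler_sum => j _.
have : `|hx v ord0 j| + `|hy v ord0 j| <= S.
  by rewrite /S (bigD1 j)//= lerDl sumr_ge0// => i _; rewrite addr_ge0.
have := normr_ge0 (hx v ord0 j); have := normr_ge0 (hy v ord0 j).
rewrite -!expr2 -[hx v ord0 j ^+ 2]real_normK ?num_real//.
rewrite -[hy v ord0 j ^+ 2]real_normK ?num_real//.
nra.
Qed.

Lemma dcc_le_poly X Y T p q B :
  (forall s, T^`().[s] = 2 * \sum_j ((Y j).[s] * (X j)^`().[s] - (X j).[s] * (Y j)^`().[s])) ->
  poly_curve X Y T 0 = p -> poly_curve X Y T 1 = q ->
  (forall s, 0 <= s <= 1 -> \sum_j (`|(X j)^`().[s]| + `|(Y j)^`().[s]|) <= B) ->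
  (dcc p q <= B%:E)%E.
Proof.
move=> HT H0 H1 HB.
apply: (@le_trans _ _ (cc_length 0 1 (poly_curve X Y T))).
  apply: ereal_inf_lbound; exists 0, 1, (poly_curve X Y T); split => //.
  exact: poly_curve_horizontal.
have B0 : 0 <= B.
  apply: le_trans (HB 0 _); last by rewrite lexx ler01.
  by apply: sumr_ge0 => j _; rewrite addr_ge0.
apply: (@le_trans _ _ (\int[mu]_(s in `[0%R, 1%R]) (cst B%:E) s)%E).
  apply: le_ge0_integral => [s _|s _|s]; rewrite ?lee_fin ?hnorm_ge0// => s01.
  split=> //.
  have [_ ->] := poly_curve_derive X Y T s.
  apply: (le_trans (hnorm_le_sum _)).
  apply: le_trans (HB s _); last by move: s01; rewrite /= in_itv.
  by apply: ler_sum => j _; rewrite /hx /hy /= !mxE.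
rewrite integral_cst//= lebesgue_measure_itv/= lte_fin ltr01.
by rewrite sube0 mule1.
Qed.

(* P and Q vanish at 0 and 1 and have mean zero there, so the plane loop (cP, dQ)
   closes up, does not interact with the segment it is added to, and encloses
   an area proportional to c d. *)
Let P : {poly R} := 'X - 3 *: 'X^2 + 2 *: 'X^3.
Let IP : {poly R} := (1 / 2) *: 'X^2 - 'X^3 + (1 / 2) *: 'X^4.
Let Q : {poly R} := - 'X + 6 *: 'X^2 - 10 *: 'X^3 + 5 *: 'X^4.
Let IQ : {poly R} := - (1 / 2) *: 'X^2 + 2 *: 'X^3 - (5 / 2) *: 'X^4 + 'X^5.
Let W : {poly R} := - 'X^3 + 4 *: 'X^4 - (33 / 5) *: 'X^5 + 5 *: 'X^6 - (10 / 7) *: 'X^7.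

Lemma dcc_le (n0 : (0 < n)%N) p q :
  (dcc p q <= (400 * n%:R * (`|q.1 - p.1| + Num.sqrt `|tau p q|))%:E)%E.
Proof.
pose i0 := Ordinal n0.
pose del (j : 'I_n) : R := (j == i0)%:R.
pose al j := hx q ord0 j - hx p ord0 j.
pose be j := hy q ord0 j - hy p ord0 j.
(* The loop changes the endpoint of [T] by 2 c d W(1) = - 2 c d / 35, which has to equal [tau p q].
   Taking c and |d| of equal size, with opposite signs when [tau] is positive, makes both O(sqrt
   |tau|). *)
pose c := Num.sqrt (35 / 2 * `|tau p q|).
pose d := - Num.sg (tau p q) * c.
have cd : 2 * (c * d) = - 35 * tau p q.
  have c2 : c ^+ 2 = 35 / 2 * `|tau p q| by rewrite sqr_sqrtr// mulr_ge0.
  have -> : 2 * (c * d) = - 2 * Num.sg (tau p q) * c ^+ 2 by rewrite /d; ring.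
  by rewrite c2 {3}[tau p q]numEsg; field.
have c0 : 0 <= c by exact: sqrtr_ge0.
have dc : `|d| <= c.
  by rewrite /d normrM normrN normr_sg (ger0_norm c0); case: (_ != 0); rewrite ?mul1r ?mul0r.
have cle : c <= 5 * Num.sqrt `|tau p q|.
  rewrite -(@ger0_norm _ 5)// -sqrtr_sqr -sqrtrM ?sqr_ge0// ler_wsqrtr//.
  by have := normr_ge0 (tau p q); nra.
clearbody c d.
pose X j : {poly R} := (hx p ord0 j)%:P + al j *: 'X + (c * del j) *: P.
pose Y j : {poly R} := (hy p ord0 j)%:P + be j *: 'X + (d * del j) *: Q.
(* An explicit antiderivative of the vertical speed required by horizontality. [IP] and [IQ] are
   antiderivatives of [P] and [Q], and [W] is one of Q P' - P Q'. The mixed terms of segment and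
   loop integrate to s P - 2 IP and 2 IQ - s Q, which vanish at both ends. *)
pose T : {poly R} := p.2%:P + \sum_j (2 *: (hy p ord0 j *: X j - hx p ord0 j *: Y j
   + (c * be j * del j) *: ('X * P - 2 *: IP)
   + (d * al j * del j) *: (2 *: IQ - 'X * Q) + (c * d * del j) *: W)).
have term_deriv (A B P1 P2 Q1 Q2 V : {poly R}) (a1 a2 a3 a4 a5 s : R) :
    (2 *: (a1 *: A - a2 *: B + a3 *: ('X * P1 - 2 *: P2)
      + a4 *: (2 *: Q2 - 'X * Q1) + a5 *: V))^`().[s] =
    2 * (a1 * A^`().[s] - a2 * B^`().[s] + a3 * (P1.[s] + s * P1^`().[s] - 2 * P2^`().[s])
      + a4 * (2 * Q2^`().[s] - Q1.[s] - s * Q1^`().[s]) + a5 * V^`().[s]).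
  by rewrite !(derivD, derivN, derivZ, derivM, derivX, hornerE)/=; ring.
have term_eval (A B P1 P2 Q1 Q2 V : {poly R}) (a1 a2 a3 a4 a5 s : R) :
    (2 *: (a1 *: A - a2 *: B + a3 *: ('X * P1 - 2 *: P2)
      + a4 *: (2 *: Q2 - 'X * Q1) + a5 *: V)).[s] =
    2 * (a1 * A.[s] - a2 * B.[s] + a3 * (s * P1.[s] - 2 * P2.[s])
      + a4 * (2 * Q2.[s] - s * Q1.[s]) + a5 * V.[s]).
  by rewrite !hornerE.
have PE s : P.[s] = s - 3 * s ^+ 2 + 2 * s ^+ 3 by rewrite /P !hornerE.
have QE s : Q.[s] = - s + 6 * s ^+ 2 - 10 * s ^+ 3 + 5 * s ^+ 4 by rewrite /Q !hornerE.
have P'E s : P^`().[s] = 1 - 6 * s + 6 * s ^+ 2.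
  by rewrite /P !(poly.derivE, hornerE)/=; ring.
have Q'E s : Q^`().[s] = - 1 + 12 * s - 30 * s ^+ 2 + 20 * s ^+ 3.
  by rewrite /Q !(poly.derivE, hornerE)/=; ring.
have IP'E s : IP^`().[s] = P.[s].
  by rewrite PE /IP !(poly.derivE, hornerE)/=; field.
have IQ'E s : IQ^`().[s] = Q.[s].
  by rewrite QE /IQ !(poly.derivE, hornerE)/=; field.
have W'E s : W^`().[s] = Q.[s] * P^`().[s] - P.[s] * Q^`().[s].
  by rewrite PE QE P'E Q'E /W !(poly.derivE, hornerE)/=; field.
have IPE : (IP.[0] = 0) * (IP.[1] = 0).
  by split; rewrite /IP !hornerE/=; field.
have IQE : (IQ.[0] = 0) * (IQ.[1] = 0).
  by split; rewrite /IQ !hornerE/=; field.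
have WE : (W.[0] = 0) * (W.[1] = - 1 / 35).
  by split; rewrite /W !hornerE/=; field.
have XE j s : (X j).[s] = hx p ord0 j + al j * s + c * del j * P.[s].
  by rewrite /X !hornerE.
have YE j s : (Y j).[s] = hy p ord0 j + be j * s + d * del j * Q.[s].
  by rewrite /Y !hornerE.
have X'E j s : (X j)^`().[s] = al j + c * del j * P^`().[s].
  by rewrite /X !(derivD, derivZ, derivC, derivX, hornerE).
have Y'E j s : (Y j)^`().[s] = be j + d * del j * Q^`().[s].
  by rewrite /Y !(derivD, derivZ, derivC, derivX, hornerE).
apply: (@dcc_le_poly X Y T).
- move=> s; rewrite /T derivD derivC add0r raddf_sum horner_sum mulr_sumr.
  apply: eq_bigr => j _.
  rewrite term_deriv XE YE X'E Y'E IP'E IQ'E W'E.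
  have del2 : del j * del j = del j by rewrite /del; case: (j == i0); rewrite ?mulr1 ?mulr0.
  by ring: del2.
- rewrite /poly_curve [p]surjective_pairing [p.1]surjective_pairing; congr (_, _, _).
  + by apply/rowP => j; rewrite mxE XE PE /hx; ring.
  + by apply/rowP => j; rewrite mxE YE QE /hy; ring.
  + rewrite /T hornerD hornerC horner_sum big1 ?addr0// => j _.
    rewrite term_eval XE YE PE QE IPE IQE WE; ring.
- rewrite /poly_curve [q]surjective_pairing [q.1]surjective_pairing; congr (_, _, _).
  + by apply/rowP => j; rewrite mxE XE PE /al /hx; ring.
  + by apply/rowP => j; rewrite mxE YE QE /be /hy; ring.
  + rewrite /T hornerD hornerC horner_sum.
    under eq_bigr do rewrite term_eval XE YE PE QE IPE IQE WE.
    have -> : q.2 = p.2 + (tau p q - 2 * omega p.1 q.1) by rewrite /tau; ring.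
    congr (_ + _).
    have -> : tau p q = \sum_j (tau p q * del j).
      by rewrite (bigD1 i0)//= big1 ?addr0 /del ?eqxx ?mulr1// => j /negbTE ->; rewrite mulr0.
    rewrite /omega mulr_sumr -sumrB; apply: eq_bigr => j _.
    have -> : tau p q = - (2 * (c * d)) / 35 by rewrite cd; field.
    by rewrite /al /be /hx /hy; field.
- move=> s s01.
  have alz j : `|al j| <= `|q.1 - p.1|.
    rewrite prod_normE le_max; apply/orP; left.
    by rewrite [leRHS]/Num.norm/= mx_normrE; apply: le_trans (le_bigmax _ _ (ord0, j)); rewrite /= !mxE.
  have bez j : `|be j| <= `|q.1 - p.1|.
    rewrite prod_normE le_max; apply/orP; right.
    by rewrite [leRHS]/Num.norm/= mx_normrE; apply: le_trans (le_bigmax _ _ (ord0, j)); rewrite /= !mxE.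
  have del01 j : `|del j| <= 1 by rewrite /del; case: (_ == _); rewrite ?normr1 ?normr0.
  have P'b : `|P^`().[s]| <= 13.
    by rewrite P'E ler_norml; case/andP: s01 => ? ?; apply/andP; split; nra.
  have Q'b : `|Q^`().[s]| <= 63.
    rewrite Q'E ler_norml; case/andP: s01 => s0 s1.
    have s2 : 0 <= s ^+ 2 <= 1 by rewrite sqr_ge0 expr_le1.
    have s3 : 0 <= s ^+ 3 <= 1 by rewrite exprn_ge0// expr_le1.
    by case/andP: s2 => ? ?; case/andP: s3 => ? ?; apply/andP; split; lra.
  set z := `|q.1 - p.1|; set t := Num.sqrt `|tau p q|.
  have z0 : 0 <= z by exact: normr_ge0.
  have t0 : 0 <= t by exact: sqrtr_ge0.
  have prodb (x y b1 b2 : R) : `|x| <= b1 -> `|y| <= b2 -> `|x * y| <= b1 * b2.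
    by move=> h1 h2; rewrite normrM ler_pM.
  (* The constant 400 dominates 5 (13 + 63), from [cle] and the crude bounds on P' and Q'. *)
  apply: (@le_trans _ _ (\sum_(j < n) (400 * (z + t)))).
    apply: ler_sum => j _; rewrite X'E Y'E.
    have c1 : `|c| <= c by rewrite ger0_norm.
    have := prodb _ _ _ _ (prodb _ _ _ _ c1 (del01 j)) P'b.
    have := prodb _ _ _ _ (prodb _ _ _ _ dc (del01 j)) Q'b.
    have := ler_normD (al j) (c * del j * P^`().[s]).
    have := ler_normD (be j) (d * del j * Q^`().[s]).
    have := alz j; have := bez j; rewrite -/z -/t in cle *; lra.
  by rewrite sumr_const card_ord -mulr_natl; lra.
Qed.
End DccUpper.

(** * Almost isotropic families *)

Section Isotropic.
Context {R : realType} {n : nat}.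
Notation zn := ('rV[R]_n * 'rV[R]_n)%type.

Lemma omega_suml k (c : 'I_k -> R) (A : 'I_k -> zn) b :
  omega (\sum_i c i *: A i) b = \sum_i c i * omega (A i) b.
Proof.
rewrite (@big_morph _ _ (fun a => omega a b) 0 +%R 0 +%R).
- by apply: eq_bigr => i _; rewrite omegaZl.
- by move=> x y; rewrite omegaDl.
- by apply: big1 => j _; rewrite /= !mxE; ring.
Qed.

Lemma omega_sumr k (c : 'I_k -> R) (A : 'I_k -> zn) b :
  omega b (\sum_i c i *: A i) = \sum_i c i * omega b (A i).
Proof.
by rewrite omegaC omega_suml -sumrN; apply: eq_bigr => i _; rewrite -mulrN -omegaC.
Qed.

(* The rows A_i and J A_i are 2k > 2n vectors of R^(2n), hence dependent:
   S(c) = - J S(d) for some coefficients c and d, and then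
   |S(c)|^2 = |S(d)|^2 = omega (S(c)) (S(d)) is controlled by the pairings of the A_i. *)
Lemma isotropic_degenerate k (nk : (n < k)%N) (A : 'I_k -> zn) (kappa : R) :
  (forall i j, `|omega (A i) (A j)| <= kappa) ->
  exists (c : 'I_k -> R) (i0 : 'I_k), [/\ c i0 = 1, forall i, `|c i| <= 1 &
    `|\sum_i c i *: A i| ^+ 2 <= k%:R ^+ 2 * kappa].
Proof.
move=> Akappa.
pose X : 'M[R]_(k, n) := \matrix_(i, j) (A i).1 ord0 j.
pose Y : 'M[R]_(k, n) := \matrix_(i, j) (A i).2 ord0 j.
pose B := col_mx (row_mx X Y) (row_mx (- Y) X).
have kerB : kermx B != 0.
  rewrite kermx_eq0 /row_free; apply/eqP => rB.
  by have := rank_leq_col B; rewrite rB; lia.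
have [v /sub_kermxP vB v0] : exists2 v : 'rV_(k + k), (v <= kermx B)%MS & v != 0.
  by exists (nz_row (kermx B)); [exact: nz_row_sub|rewrite nz_row_eq0].
pose S (c : 'I_k -> R) := \sum_i c i *: A i.
have S1 c j : (S c).1 ord0 j = \sum_i c i * X i j.
  rewrite /S (@big_morph _ _ (fun a : zn => a.1 ord0 j) 0 +%R 0 +%R).
  - by apply: eq_bigr => i _; rewrite !mxE.
  - by move=> x y; rewrite mxE.
  - by rewrite mxE.
have S2 c j : (S c).2 ord0 j = \sum_i c i * Y i j.
  rewrite /S (@big_morph _ _ (fun a : zn => a.2 ord0 j) 0 +%R 0 +%R).
  - by apply: eq_bigr => i _; rewrite !mxE.
  - by move=> x y; rewrite mxE.
  - by rewrite mxE.
pose c i := v ord0 (lshift k i); pose d i := v ord0 (rshift k i).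
have vE : v = row_mx (\row_i c i) (\row_i d i).
  by apply/rowP => i; rewrite mxE; case: splitP => j ij; rewrite mxE; congr (v _ _);
    apply/val_inj.
move: vB; rewrite vE mul_row_col !mul_mx_row add_row_mx => /eqP.
rewrite -[0]row_mx0 => /eqP/eq_row_mx[E1 E2].
have {}E1 j : (S c).1 ord0 j = (S d).2 ord0 j.
  rewrite S1 S2; move/rowP: E1 => /(_ j); rewrite mulmxN !mxE => /eqP; rewrite subr_eq0.
  move=> /eqP E; transitivity (\sum_i (\row_i c i) ord0 i * X i j).
    by apply: eq_bigr => i _; rewrite mxE.
  by rewrite E; apply: eq_bigr => i _; rewrite mxE.
have {}E2 j : (S c).2 ord0 j = - (S d).1 ord0 j.
  rewrite S1 S2; move/rowP: E2 => /(_ j); rewrite !mxE => /eqP; rewrite addr_eq0.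
  move=> /eqP E; transitivity (\sum_i (\row_i c i) ord0 i * Y i j).
    by apply: eq_bigr => i _; rewrite mxE.
  by rewrite E; congr (- _); apply: eq_bigr => i _; rewrite mxE.
have sq_le (a : zn) : `|a| ^+ 2 <= \sum_j (a.1 ord0 j ^+ 2 + a.2 ord0 j ^+ 2).
  set s := \sum_j _.
  have s0 : 0 <= s by apply: sumr_ge0 => j _; rewrite addr_ge0 ?sqr_ge0.
  have le_s j : `|a.1 ord0 j| <= Num.sqrt s /\ `|a.2 ord0 j| <= Num.sqrt s.
    have : a.1 ord0 j ^+ 2 + a.2 ord0 j ^+ 2 <= s.
      by rewrite /s (bigD1 j)//= lerDl sumr_ge0// => i _; rewrite addr_ge0 ?sqr_ge0.
    by move=> H; split; rewrite -sqrtr_sqr ler_wsqrtr//; apply: le_trans H;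
      rewrite ?lerDl ?lerDr sqr_ge0.
  rewrite -(sqr_sqrtr s0) lerXn2r// ?nnegrE ?sqrtr_ge0//.
  rewrite prod_normE ge_max; apply/andP; split; rewrite [leLHS]/Num.norm/= mx_normrE;
    (apply: bigmax_le => [|[i j] _ /=]; [exact: sqrtr_ge0|rewrite (ord1 i)]);
    by case: (le_s j).
have Sc : `|S c| ^+ 2 <= omega (S c) (S d).
  apply: (le_trans (sq_le _)); apply: ler_sum => j _.
  by rewrite E1 E2; lra.
have Sd : `|S d| ^+ 2 <= omega (S c) (S d).
  apply: (le_trans (sq_le _)); apply: ler_sum => j _.
  by rewrite E1 E2; lra.
(* The largest coefficient among [c] and [d] together serves for normalisation. Whichever family
   contains it gives the combination, since [S c] and [S d] obey the same bound. *)
pose i1 : 'I_(k + k) := lshift k (Ordinal nk).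
pose im := [arg max_(i > i1) `|v ord0 i|]%O.
have imP i : `|v ord0 i| <= `|v ord0 im|.
  by rewrite /im; case: arg_maxP => //= i' _; apply.
set m := `|v ord0 im|.
have m0 : 0 < m.
  rewrite lt_neqAle normr_ge0 andbT eq_sym; apply: contra_neq v0 => m0.
  by apply/rowP => i; apply/eqP; rewrite mxE -normr_le0 -m0; exact: imP.
have om : omega (S c) (S d) <= k%:R ^+ 2 * kappa * m ^+ 2.
  apply: (le_trans (ler_norm _)); rewrite omega_suml.
  apply: (@le_trans _ _ (\sum_(i < k) \sum_(j < k) (m ^+ 2 * kappa))).
    apply: (le_trans (ler_norm_sum _ _ _)); apply: ler_sum => i _.
    rewrite omega_sumr mulr_sumr; apply: (le_trans (ler_norm_sum _ _ _)).
    apply: ler_sum => j _; rewrite !normrM mulrA expr2.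
    by rewrite !ler_pM ?mulr_ge0//; exact: imP.
  by rewrite sumr_const card_ord -mulr_natl sumr_const card_ord -[(m ^+ 2 * kappa) *+ k]mulr_natl; lra.
have final (e : 'I_k -> R) i0 : `|e i0| = m -> (forall i, `|e i| <= m) ->
    `|S e| ^+ 2 <= omega (S c) (S d) ->
    exists (c : 'I_k -> R) (i0 : 'I_k), [/\ c i0 = 1, forall i, `|c i| <= 1 &
    `|\sum_i c i *: A i| ^+ 2 <= k%:R ^+ 2 * kappa].
  move=> ei0 em Se; exists (fun i => (e i0)^-1 * e i), i0.
  have e0 : e i0 != 0 by rewrite -normr_eq0 ei0 gt_eqF.
  split; first by rewrite mulVf.
    by move=> i; rewrite normrM normfV ei0 ler_pdivrMl// mulr1.
  rewrite (eq_bigr (fun i => (e i0)^-1 *: (e i *: A i))); last by move=> i _; rewrite scalerA.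
  rewrite -scaler_sumr normrZ normfV ei0 exprMn exprVn ler_pdivrMl ?exprn_gt0//.
  by rewrite mulrC; apply: le_trans om.
case: (split_ordP im) => i0 imE.
  by apply: (final c i0) => //; [rewrite /c -imE|move=> i; exact: imP].
by apply: (final d i0) => //; [rewrite /d -imE|move=> i; exact: imP].
Qed.
End Isotropic.

(** * Chains with a nearly straight horizontal part *)

Section Chains.
Context {R : realType} {n : nat}.
Notation zn := ('rV[R]_n * 'rV[R]_n)%type.
Notation heisn := (heis R n).
Implicit Types p q r : heisn.

Lemma omega_le2 (a b : zn) (x y : R) : `|a| <= x -> `|b| <= y ->
  `|omega a b| <= 2 * n%:R * (x * y).
Proof.
move=> ax by_; apply: (le_trans (omega_le _ _)).
by rewrite -mulrA ler_wpM2l ?mulr_ge0// ler_pM.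
Qed.

(** The defect of additivity is, up to a factor, the symplectic area of the projected triangle. *)
Lemma tau_cocycle p q r :
  tau p r = tau p q + tau q r - 2 * omega (q.1 - p.1) (r.1 - p.1).
Proof.
rewrite /tau omegaDl !omegaDr !(omegaNl, omegaNr) omegaaa (omegaC q.1 p.1).
ring.
Qed.

(** A straight chain encloses no area, so only the deviations [r i] from it matter. Here [T] bounds
    the single steps, [rho] the deviations and [W] the mean step. *)
Lemma tau_chain (p : nat -> heisn) (M : nat) (w : zn) (T rho W : R) :
  (forall i, (i < M)%N -> `|tau (p i) (p i.+1)| <= T) ->
  (forall i, (i <= M)%N -> `|(p i).1 - (p 0%N).1 - i%:R *: w| <= rho) ->
  `|w| <= W ->
  `|tau (p 0%N) (p M)| <= M%:R * (T + 12 * n%:R * W * rho + 4 * n%:R * rho ^+ 2).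
Proof.
move=> HT Hrho HW.
have W0 : 0 <= W by apply: le_trans HW.
have rho0 : 0 <= rho by apply: le_trans (Hrho 0%N (leq0n _)).
have [r [rE Hr]] : exists r : nat -> zn, (forall i, (p i).1 - (p 0%N).1 = i%:R *: w + r i) /\
    (forall i, (i <= M)%N -> `|r i| <= rho).
  exists (fun i => (p i).1 - (p 0%N).1 - i%:R *: w); split=> // i.
  by rewrite addrCA subrr addr0.
(* Each new triangle contributes terms of size i W rho, which would add up to order M^2. The
   correction 2 i omega(w, r_i) makes them telescope (summation by parts), leaving O(W rho + rho^2)
   per step. Removing it at i = M turns 8 into 12. *)
have step i : (i <= M)%N ->
    `|tau (p 0%N) (p i) + 2 * i%:R * omega w (r i)| <=
    i%:R * (T + 8 * n%:R * W * rho + 4 * n%:R * rho ^+ 2).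
  elim: i => [_|i IH iM].
    by rewrite /tau omegaaa subrr !(mulr0, mul0r, addr0, normr0).
  have om1 := omega_le2 HW (Hr _ iM).
  have om2 := omega_le2 HW (Hr _ (ltnW iM)).
  have om3 := omega_le2 (Hr _ (ltnW iM)) (Hr _ iM).
  have {}IH := IH (ltnW iM); have Ti := HT _ iM.
  rewrite (tau_cocycle _ (p i)) !rE omegaDl !omegaDr !(omegaZl, omegaZr) omegaaa.
  rewrite (omegaC (r i) w).
  set a := tau (p 0%N) (p i) in IH *; set b := tau (p i) _ in Ti *.
  set o1 := omega w (r i.+1) in om1 *; set o2 := omega w (r i) in om2 IH *.
  set o3 := omega (r i) (r i.+1) in om3 *.
  rewrite [X in `|X| <= _](_ : _ = (a + 2 * i%:R * o2) + b + 2 * o1 + 2 * o2 - 2 * o3); last first.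
    by rewrite -[i.+1%:R]natr1; ring.
  rewrite -[i.+1%:R]natr1 [leRHS]mulrDl mul1r.
  move: (a + 2 * i%:R * o2) IH => A IH.
  move: IH; set B := T + _ + _; set iB := i%:R * B => IH.
  have sB : `|b + 2 * o1 + 2 * o2 - 2 * o3| <= B.
    rewrite /B; move: Ti om1 om2 om3; rewrite !ler_norml.
    move=> /andP[? ?] /andP[? ?] /andP[? ?] /andP[? ?].
    by apply/andP; split; lra.
  rewrite (_ : A + b + 2 * o1 + 2 * o2 - 2 * o3 = A + (b + 2 * o1 + 2 * o2 - 2 * o3)); last by ring.
  by apply: (le_trans (ler_normD _ _)); apply: lerD.
have HM := step M (leqnn M).
have om2 := omega_le2 HW (Hr _ (leqnn M)).
have : `|2 * M%:R * omega w (r M)| <= 2 * M%:R * (2 * n%:R * (W * rho)).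
  by rewrite normrM ger0_norm ?mulr_ge0// ler_wpM2l ?mulr_ge0.
have := ler_normB (tau (p 0%N) (p M) + 2 * M%:R * omega w (r M)) (2 * M%:R * omega w (r M)).
rewrite addrK; lra.
Qed.
End Chains.

(** * Cubes with an almost affine horizontal part *)

Section GoodCube.
Context {R : realType} {n k : nat}.
Hypotheses (n0 : (0 < n)%N) (nk : (n < k)%N).
Notation zn := ('rV[R]_n * 'rV[R]_n)%type.
Notation heisn := (heis R n).
Implicit Types (p q : heisn) (b : 'I_k -> nat).

Lemma ler_norm_sumZ (c : 'I_k -> R) (D : 'I_k -> zn) (x y : R) :
  (forall i, `|c i| <= x) -> (forall i, `|D i| <= y) ->
  `|\sum_i c i *: D i| <= k%:R * (x * y).
Proof.
move=> cx Dy; apply: (le_trans (ler_norm_sum _ _ _)).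
apply: (@le_trans _ _ (\sum_(i < k) (x * y))).
  by apply: ler_sum => i _; rewrite normrZ ler_pM.
by rewrite sumr_const card_ord mulr_natl.
Qed.

(** The bound of [tau_chain] per step and in units of h^2, for T = C h^2, W = k C h and rho = (2 +
    k) C h. *)
Definition chain_const (C : R) : R :=
  C + (12 * n%:R * k%:R * (2 + k%:R) + 4 * n%:R * (2 + k%:R) ^+ 2) * C ^+ 2.

Definition isotropy_const (C : R) : R := 6 * chain_const C + 32 * n%:R * C ^+ 2.

(** The factor of [dcc_le] times the sum of the horizontal bound [z_le] and the vertical bound
    [t_le] of [cube_key], in units of r0 h. *)
Definition cube_const (C : R) : R :=
  400 * n%:R * (k%:R * C + k%:R * (isotropy_const C + 1) + 2 * C + chain_const C + 1).

Lemma chain_const_ge0 C : 0 <= C -> 0 <= chain_const C.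
Proof.
move=> C0; rewrite /chain_const addr_ge0// mulr_ge0 ?sqr_ge0// addr_ge0// !mulr_ge0// ?addr_ge0//.
Qed.

Lemma cube_const_ge0 C : 0 <= C -> 0 <= cube_const C.
Proof.
move=> C0; have := chain_const_ge0 C0 => c1.
have c2 : 0 <= isotropy_const C by rewrite /isotropy_const addr_ge0// !mulr_ge0// sqr_ge0.
by rewrite /cube_const !(mulr_ge0, addr_ge0).
Qed.

(* F b p: the point p is attained over the cell b of a cube divided into
   M^k cells, h is the side of a cell and D the (rescaled) slopes. *)
Variables (F : ('I_k -> nat) -> heisn -> Prop) (M : nat) (h C : R) (z0 : zn) (D : 'I_k -> zn).
Hypotheses (h0 : 0 < h) (C0 : 0 <= C) (M2 : (2 <= M)%N).
Hypothesis Fex : forall b, (forall i, b i < M)%N -> exists p, F b p.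
Hypothesis Ftau : forall b b' p q, (forall i, b i < M)%N -> (forall i, b' i < M)%N ->
  F b p -> F b' q -> (forall i, b i <= (b' i).+1 /\ b' i <= (b i).+1)%N ->
  `|tau p q| <= C * h ^+ 2.
Hypothesis Fz : forall b p, (forall i, b i < M)%N -> F b p ->
  `|p.1 - z0 - \sum_i (b i)%:R *: D i| <= C * h.
Hypothesis FD : forall i, `|D i| <= C * h.

Let M0 : (0 < M)%N. Proof. by apply: leq_trans M2. Qed.

Let Fdiff b b' p q : (forall i, b i < M)%N -> (forall i, b' i < M)%N ->
  F b p -> F b' q ->
  `|q.1 - p.1 - \sum_i ((b' i)%:R - (b i)%:R) *: D i| <= 2 * (C * h).
Proof.
move=> bM b'M Fp Fq.
have -> : q.1 - p.1 - \sum_i ((b' i)%:R - (b i)%:R) *: D i =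
    (q.1 - z0 - \sum_i (b' i)%:R *: D i) - (p.1 - z0 - \sum_i (b i)%:R *: D i).
  under eq_bigr do rewrite scalerBl.
  rewrite sumrB; set s := \sum_i _; set s' := \sum_i _.
  by rewrite !opprD !opprK !addrA [RHS](ACl (1*4*3*6*(2*5)))/= addNr addr0.
apply: (le_trans (ler_normB _ _)).
by have := Fz bM Fp; have := Fz b'M Fq; lra.
Qed.

Notation C1 := (chain_const C).
Notation C2 := (isotropy_const C).
Notation C3 := (cube_const C).

Let C1_ge0 : 0 <= C1 := chain_const_ge0 C0.

(* Joining the two cells by a discrete segment, the image chain is a straight
   chain up to O(h), so the M steps only contribute O(M h^2). *)
Lemma cube_tau_le b b' p q : (forall i, b i < M)%N -> (forall i, b' i < M)%N ->
  F b p -> F b' q -> `|tau p q| <= C1 * M%:R * h ^+ 2.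
Proof.
move=> bM b'M Fp Fq.
(* Linear interpolation of indices, rounded down. Each coordinate moves by at most one per step, so
   consecutive cells are neighbours; rounding costs less than one unit per coordinate, which is the
   summand k in rho = (2 + k) C h. *)
pose c (i : nat) : 'I_k -> nat := fun l => ((b l * (M - i) + b' l * i) %/ M)%N.
have cM i l : (i <= M)%N -> (c i l < M)%N.
  move=> iM; rewrite /c ltn_divLR//; have := bM l; have := b'M l.
  move: (b l) (b' l) => x y; nia.
have c0 : c 0%N = b by apply/funext => l; rewrite /c muln0 addn0 subn0 mulnK.
have cMM : c M = b' by apply/funext => l; rewrite /c subnn muln0 add0n mulnK.
pose P i := if i == 0%N then p else if i == M then q else
  if pselect (exists p', F (c i) p') is left H then sval (cid H) else p.
have FP i : (i <= M)%N -> F (c i) (P i).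
  move=> iM; rewrite /P; case: eqP => [->|_]; first by rewrite c0.
  case: eqP => [->|_]; first by rewrite cMM.
  case: pselect => [H|H]; first by case: (cid H).
  by case: H; apply: Fex => l; exact: cM.
have P0 : P 0%N = p by [].
have PM : P M = q by rewrite /P eqxx; case: eqP => // ME; move: M0; rewrite ME.
pose w : zn := \sum_l (((b' l)%:R - (b l)%:R) / M%:R) *: D l.
have MR0 : 0 < M%:R :> R by rewrite ltr0n.
have dle1 x y : (x < M)%N -> (y < M)%N -> `|y%:R - x%:R| <= M%:R :> R.
  move=> xM yM; have : x%:R <= M%:R :> R by rewrite ler_nat ltnW.
  have : y%:R <= M%:R :> R by rewrite ler_nat ltnW.
  have := ler0n R x; have := ler0n R y.
  by rewrite ler_norml => *; apply/andP; split; lra.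
have HW : `|w| <= k%:R * (1 * (C * h)).
  apply: ler_norm_sumZ => // i.
  by rewrite normrM normfV (ger0_norm (ltW MR0)) ler_pdivrMr// mul1r dle1.
have := @tau_chain R n P M w (C * h ^+ 2) ((2 + k%:R) * (C * h)) (k%:R * (1 * (C * h))).
rewrite P0 PM => /(_ _ _ HW) chain.
apply: le_trans (chain _ _) _.
- move=> i iM; apply: (Ftau _ _ (FP i (ltnW iM)) (FP i.+1 iM)).
  + by move=> l; apply: cM; exact: ltnW.
  + by move=> l; exact: cM.
  + move=> l; have bl := bM l; have b'l := b'M l; rewrite /c.
    set x := (b l * (M - i) + _)%N; set y := (b l * (M - i.+1) + _)%N.
    have xy : (x <= y + M)%N by rewrite /x /y; nia.
    have yx : (y <= x + M)%N by rewrite /x /y; nia.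
    have := leq_div2r M xy; have := leq_div2r M yx.
    have dS z : ((z + M) %/ M = (z %/ M).+1)%N by rewrite addnC -{1}[M]mul1n divnMDl.
    by rewrite !dS.
- move=> i iM.
  have -> : (P i).1 - p.1 - i%:R *: w = ((P i).1 - p.1 - \sum_l ((c i l)%:R - (b l)%:R) *: D l)
     + \sum_l (((c i l)%:R - (b l)%:R) - i%:R * (((b' l)%:R - (b l)%:R) / M%:R)) *: D l.
    rewrite [X in _ = _ + X](_ : _ = \sum_l ((c i l)%:R - (b l)%:R) *: D l - i%:R *: w).
      by rewrite addrA subrK.
    by rewrite /w scaler_sumr -sumrB; apply: eq_bigr => l _; rewrite scalerBl scalerA.
  apply: (le_trans (ler_normD _ _)).
  have := Fdiff bM (fun l => cM i l iM) Fp (FP i iM).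
  have : `|\sum_l (((c i l)%:R - (b l)%:R) - i%:R * (((b' l)%:R - (b l)%:R) / M%:R)) *: D l|
      <= k%:R * (1 * (C * h)).
    apply: ler_norm_sumZ => // l.
    have := divn_eq (b l * (M - i) + b' l * i) M; rewrite -/(c i l).
    have := ltn_pmod (b l * (M - i) + b' l * i) M0.
    move: (_ %% M)%N => r rM /(congr1 (fun x : nat => x%:R : R)).
    rewrite !(natrD, natrM) natrB// => E.
    have {}rM : r%:R <= M%:R :> R by rewrite ler_nat ltnW.
    have r0 : 0 <= r%:R :> R by [].
    have -> : (c i l)%:R - (b l)%:R - i%:R * (((b' l)%:R - (b l)%:R) / M%:R) = - (r%:R / M%:R) :> R.
      have -> : r%:R = (b l)%:R * (M%:R - i%:R) + (b' l)%:R * i%:R - (c i l)%:R * M%:R :> R.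
        by rewrite E addrC addKr.
      by field; rewrite lt0r_neq0.
    by rewrite normrN ger0_norm ?divr_ge0// ler_pdivrMr// mul1r.
  lra.
- by rewrite /chain_const; lra.
Qed.

(** Compare points over the corner cell and over the far ends of the edges i and j. All three values
    of [tau] are O(M h^2), so by the cocycle identity (M - 1)^2 omega(D_i, D_j) is O(M h^2) too; M
    >= 2 allows replacing (M - 1)^2 by M^2 / 4. *)
Lemma cube_isotropic i j : `|omega (D i) (D j)| <= C2 * h ^+ 2 / M%:R.
Proof.
have MR2 : 2 <= M%:R :> R by rewrite ler_nat.
have Ch0 : 0 <= C * h by rewrite mulr_ge0// ltW.
pose e (l : 'I_k) : 'I_k -> nat := fun l' => if l' == l then M.-1 else 0%N.
have eM l l' : (e l l' < M)%N by rewrite /e; case: ifP => // _; rewrite prednK.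
pose z : 'I_k -> nat := fun=> 0%N.
have zM l : (z l < M)%N by [].
have [p Fp] := Fex zM; have [q Fq] := Fex (eM i); have [r Fr] := Fex (eM j).
have eE l : \sum_l' ((e l l')%:R - (z l')%:R) *: D l' = (M%:R - 1) *: D l.
  rewrite (bigD1 l)//= big1 ?addr0 => [|l' /negbTE ne].
    by rewrite /e eqxx /z subr0 -subn1 natrB.
  by rewrite /e ne /z subrr scale0r.
have := Fdiff zM (eM i) Fp Fq; have := Fdiff zM (eM j) Fp Fr; rewrite !eE.
set b := _ - _ *: D j; set a := _ - _ *: D i => bC aC.
have qE : q.1 - p.1 = (M%:R - 1) *: D i + a by rewrite /a addrCA subrr addr0.
have rE : r.1 - p.1 = (M%:R - 1) *: D j + b by rewrite /b addrCA subrr addr0.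
clearbody a b.
have tpq := cube_tau_le zM (eM i) Fp Fq.
have tpr := cube_tau_le zM (eM j) Fp Fr.
have tqr := cube_tau_le (eM i) (eM j) Fq Fr.
have := tau_cocycle p q r; rewrite qE rE omegaDl !omegaDr !(omegaZl, omegaZr).
have o1 := omega_le2 aC (FD j); have o2 := omega_le2 (FD i) bC; have o3 := omega_le2 aC bC.
set o := omega (D i) (D j); set m := M%:R in MR2 tpq tpr tqr *.
set x1 := omega a (D j) in o1 *; set x2 := omega (D i) b in o2 *; set x3 := omega a b in o3 *.
move=> cyc.
have m1 : 0 <= m - 1 by lra.
have key : `|2 * ((m - 1) ^+ 2 * o)| <= 3 * (C1 * m * h ^+ 2) + 16 * n%:R * m * C ^+ 2 * h ^+ 2.
  have -> : 2 * ((m - 1) ^+ 2 * o) = (tau p q + tau q r - tau p r)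
      - 2 * ((m - 1) * x1) - 2 * ((m - 1) * x2) - 2 * x3 by rewrite cyc; ring.
  have y1 : `|(m - 1) * x1| <= (m - 1) * (2 * n%:R * (2 * (C * h) * (C * h))).
    by rewrite normrM (ger0_norm m1) ler_wpM2l.
  have y2 : `|(m - 1) * x2| <= (m - 1) * (2 * n%:R * (C * h * (2 * (C * h)))).
    by rewrite normrM (ger0_norm m1) ler_wpM2l.
  move: ((m - 1) * x1) ((m - 1) * x2) y1 y2 => {cyc}{}x1 {}x2 {}o1 {}o2.
  apply: (le_trans (ler_normB _ _)); apply: le_trans (lerD (ler_normB _ _) (lexx _)) _.
  apply: le_trans (lerD (lerD (ler_normB _ _) (lexx _)) (lexx _)) _.
  have := ler_normB (tau p q + tau q r) (tau p r); have := ler_normD (tau p q) (tau q r).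
  rewrite !normrM (ger0_norm (ler0n R 2)).
  have : 0 <= n%:R * C ^+ 2 * h ^+ 2 by rewrite mulr_ge0 ?sqr_ge0// mulr_ge0 ?sqr_ge0.
  lra.
have mq : m ^+ 2 / 4 <= (m - 1) ^+ 2 by nra.
have : m ^+ 2 / 4 * `|o| <= (3 * (C1 * m * h ^+ 2) + 16 * n%:R * m * C ^+ 2 * h ^+ 2) / 2.
  have : `|2 * ((m - 1) ^+ 2 * o)| = 2 * ((m - 1) ^+ 2 * `|o|).
    by rewrite normrM (ger0_norm (ler0n R 2)) normrM (ger0_norm (sqr_ge0 _)).
  have := ler_wpM2r (normr_ge0 o) mq; lra.
move=> H; rewrite ler_pdivlMr; last lra.
rewrite /isotropy_const; set u := `|o| in H *.
rewrite -(ler_pM2l (_ : 0 < m / 4)); last by lra.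
rewrite (_ : m / 4 * (u * m) = m ^+ 2 / 4 * u); last by field.
by apply: (le_trans H); rewrite le_eqVlt; apply/orP; left; apply/eqP; field.
Qed.

(* The degenerate direction c shifts every cell index to one with i0-th
   coordinate zero, which leaves only k - 1 effective dimensions. *)
Lemma cube_key (r0 : nat) : (0 < r0)%N -> M = (r0 ^ 2)%N ->
  exists key : ('I_k -> nat) -> {ffun 'I_k.-1 -> 'I_((3 * r0).-1.+1)},
    forall b b' p q, (forall i, b i < M)%N -> (forall i, b' i < M)%N ->
      F b p -> F b' q -> key b = key b' -> (dcc p q <= (C3 * r0%:R * h)%:E)%E.
Proof.
move=> r00 Mr0.
have C20 : 0 <= C2 by rewrite /isotropy_const addr_ge0// mulr_ge0 ?sqr_ge0// mulr_ge0.
have Ch0 : 0 <= C * h by rewrite mulr_ge0// ltW.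
have rR : 0 < r0%:R :> R by rewrite ltr0n.
have rR1 : 1 <= r0%:R :> R by rewrite ler1n.
have MR0 : 0 < M%:R :> R by rewrite ltr0n.
have ME : M%:R = r0%:R ^+ 2 :> R by rewrite Mr0 natrX.
have [c [i0 [ci0 c1 cD]]] := isotropic_degenerate nk cube_isotropic.
have {}cD : `|\sum_i c i *: D i| <= k%:R * (C2 + 1) * h / r0%:R.
  have rhs0 : 0 <= k%:R * (C2 + 1) * h / r0%:R.
    have hh := ltW h0; have C21 : 0 <= C2 + 1 by lra.
    by rewrite divr_ge0 ?mulr_ge0.
  rewrite -(ler_pXn2r (_ : 0 < 2)%N) ?nnegrE//; apply: (le_trans cD).
  have -> : (k%:R * (C2 + 1) * h / r0%:R) ^+ 2 = k%:R ^+ 2 * ((C2 + 1) ^+ 2 * h ^+ 2 / M%:R).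
    by rewrite ME; field; rewrite lt0r_neq0.
  rewrite ler_wpM2l ?sqr_ge0// ler_wpM2r ?invr_ge0 ?ler0n// ler_wpM2r ?sqr_ge0//; nra.
(* The index shifted along [c] until its [i0]-th coordinate vanishes, measured in units of [r0]. The
   shifted coordinate lies between - M and 2 M; adding M and dividing by r0 puts it in [0, 3 r0), as
   M = r0 ^ 2. *)
pose x b (l : 'I_k.-1) : R :=
  ((b (lift i0 l))%:R - (b i0)%:R * c (lift i0 l) + M%:R) / r0%:R.
have xb b l : (forall i, b i < M)%N -> 0 <= x b l /\ x b l < 3 * r0%:R.
  move=> bM; rewrite /x.
  have u1 : (b (lift i0 l))%:R < M%:R :> R by rewrite ltr_nat.
  have u2 : (b i0)%:R < M%:R :> R by rewrite ltr_nat.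
  have u10 : 0 <= (b (lift i0 l))%:R :> R by [].
  have u20 : 0 <= (b i0)%:R :> R by [].
  have := c1 (lift i0 l); rewrite ler_norml => /andP[? ?].
  split; first by rewrite divr_ge0//; nra.
  rewrite ltr_pdivrMr// -mulrA -expr2 -ME; nra.
exists (fun b => [ffun l => inord (Num.truncn (x b l))]) => b b' p q bM b'M Fp Fq kk.
have xx l : `|x b' l - x b l| <= 1.
  have [x0 x3] := xb b l bM; have [x0' x3'] := xb b' l b'M.
  have tr (y : R) : 0 <= y -> y < 3 * r0%:R -> (Num.truncn y < (3 * r0).-1.+1)%N.
    move=> y0 y3; rewrite prednK ?muln_gt0// -(ltr_nat R) natrM.
    by apply: le_lt_trans y3; rewrite truncn_le.
  have : Num.truncn (x b l) = Num.truncn (x b' l).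
    move/ffunP: kk => /(_ l); rewrite !ffunE => /(congr1 val) /=.
    by rewrite !inordK// ?tr.
  have := truncn_itv x0; have := truncn_itv x0' => /andP[h1 h2] /andP[h3 h4] E.
  rewrite E in h3 h4; rewrite -natr1 in h2 h4.
  by rewrite ler_norml; apply/andP; split; lra.
pose del l : R := (b' l)%:R - (b l)%:R.
(* Equal keys leave [rem] of size r0, contributing O(r0 h). The rest is a multiple, at most M, of
   the degenerate combination of norm O(h / r0), which is again O(r0 h). *)
pose rem l : R := del l - del i0 * c l.
have remE l : `|rem l| <= r0%:R.
  have [->|/negbTE ne] := eqVneq l i0; first by rewrite /rem ci0 mulr1 subrr normr0.
  case: (unliftP i0 l) => [l' lE|lE]; last by rewrite lE eqxx in ne.
  have -> : rem l = (x b' l' - x b l') * r0%:R.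
    by rewrite /rem /del /x -lE; field; rewrite lt0r_neq0.
  by rewrite normrM (ger0_norm (ltW rR)) ler_piMl// ltW.
have diffE : \sum_i del i *: D i = \sum_i rem i *: D i + del i0 *: \sum_i c i *: D i.
  rewrite scaler_sumr -big_split; apply: eq_bigr => i _ /=.
  by rewrite scalerA -scalerDl /rem subrK.
have z_le : `|q.1 - p.1| <= (k%:R * C + k%:R * (C2 + 1) + 2 * C) * r0%:R * h.
  have := Fdiff bM b'M Fp Fq; rewrite diffE => dE.
  have s1 := ler_norm_sumZ remE FD.
  have del0 : `|del i0| <= M%:R.
    have : (b i0)%:R <= M%:R :> R by rewrite ler_nat ltnW.
    have : (b' i0)%:R <= M%:R :> R by rewrite ler_nat ltnW.
    have := ler0n R (b i0); have := ler0n R (b' i0).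
    by rewrite ler_norml /del => *; apply/andP; split; lra.
  have s2 : `|del i0 *: \sum_i c i *: D i| <= k%:R * (C2 + 1) * r0%:R * h.
    rewrite normrZ; apply: (le_trans (ler_pM (normr_ge0 _) (normr_ge0 _) del0 cD)).
    by rewrite ME le_eqVlt; apply/orP; left; apply/eqP; field; rewrite lt0r_neq0.
  move: s1 s2 dE; set u := \sum_i rem i *: D i; set v := del i0 *: _ => s1 s2 dE.
  have := ler_normD (q.1 - p.1 - (u + v)) (u + v); rewrite subrK.
  have := ler_normD u v.
  have s3 := ler_peMr Ch0 rR1; lra.
(* The square root of O(M h^2) is also O(r0 h): the choice M = r0 ^ 2 balances the two parts. *)
have t_le : Num.sqrt `|tau p q| <= (C1 + 1) * r0%:R * h.
  have hh := ltW h0; have C11 : 0 <= C1 + 1 by have := C1_ge0; lra.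
  have rhs0 : 0 <= (C1 + 1) * r0%:R * h by rewrite !mulr_ge0.
  rewrite -[leRHS](ger0_norm rhs0) -[leRHS]sqrtr_sqr ler_wsqrtr//.
  apply: (le_trans (cube_tau_le bM b'M Fp Fq)); rewrite ME !exprMn.
  by rewrite ler_wpM2r ?sqr_ge0// ler_wpM2r ?sqr_ge0//; have := C1_ge0; nra.
apply: (le_trans (dcc_le n0 p q)); rewrite lee_fin /cube_const -!mulrA.
rewrite ler_wpM2l// ler_wpM2l//; lra.
Qed.
End GoodCube.

Arguments cube_const {R} n k C.

(** * Second differences on a discrete torus *)

Section FiniteDifferences.
Local Close Scope classical_set_scope.
Context {R : realFieldType} {T : finZmodType}.
Implicit Types (f g h : T -> R) (v w x : T).

Definition fdiff w g x : R := g (x + w) - g x.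

Lemma sum_shift w f : \sum_x f (x + w) = \sum_x f x.
Proof. by rewrite [RHS](reindex_inj (addIr w)). Qed.

Lemma fdiffC v w g x : fdiff v (fdiff w g) x = fdiff w (fdiff v g) x.
Proof. by rewrite /fdiff (addrAC x v w); ring. Qed.

Lemma sum_by_parts w f h :
  \sum_x fdiff w f x * h x = - \sum_x f x * fdiff w h (x - w).
Proof.
rewrite /fdiff; under eq_bigr do rewrite mulrBl.
rewrite sumrB.
have -> : \sum_x f (x + w) * h x = \sum_x f x * h (x - w).
  by rewrite -[RHS](sum_shift w); apply: eq_bigr => x _; rewrite addrK.
by rewrite -sumrB -sumrN; apply: eq_bigr => x _; rewrite subrK; ring.
Qed.

(** The discrete form of the identity between the integrals of (d_v d_w g)^2 and of (d_v d_v g)(d_w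
    d_w g) on a torus: two summations by parts, then the arithmetic-geometric mean inequality. *)
Lemma mixed_energy_le v w g :
  \sum_x fdiff v (fdiff w g) x ^+ 2 <=
  (\sum_x fdiff v (fdiff v g) x ^+ 2 + \sum_x fdiff w (fdiff w g) x ^+ 2) / 2.
Proof.
pose H x := fdiff w (fdiff w g) (x - w).
have -> : \sum_x fdiff v (fdiff w g) x ^+ 2 =
    \sum_x H x * fdiff v (fdiff v g) (x - v).
  transitivity (\sum_x fdiff w (fdiff v g) x * fdiff v (fdiff w g) x).
    by apply: eq_bigr => x _; rewrite expr2 {1}fdiffC.
  rewrite sum_by_parts.
  have -> : \sum_x fdiff v g x * fdiff w (fdiff v (fdiff w g)) (x - w) =
      \sum_x fdiff v H x * fdiff v g x.
    apply: eq_bigr => x _; rewrite mulrC; congr (_ * _).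
    by rewrite fdiffC /H /fdiff (addrAC x v) //; congr (_ - _ - (_ - _));
      congr g; rewrite -!addrA; congr (_ + _); rewrite addrC.
  by rewrite sum_by_parts opprK.
rewrite -(sum_shift (- v) (fun x => fdiff v (fdiff v g) x ^+ 2)).
rewrite -(sum_shift (- w) (fun x => fdiff w (fdiff w g) x ^+ 2)).
rewrite -big_split mulr_suml; apply: ler_sum => x _ /=.
rewrite -/(H x); have := sqr_ge0 (H x - fdiff v (fdiff v g) (x - v)); nra.
Qed.

(** Cauchy-Schwarz with part of its defect: the full defect is the sum of all (a_r - a_s)^2 with r <
    s, of which the pair 0, 1 is kept. *)
Lemma sqr_sum_gap (a : nat -> R) M : (2 <= M)%N ->
  (\sum_(r < M) a r) ^+ 2 + (a 1%N - a 0%N) ^+ 2 <= M%:R * \sum_(r < M) a r ^+ 2.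
Proof.
elim: M => [//|M IH] /=; rewrite leq_eqVlt => /predU1P[[<-]|].
  by rewrite !big_ord_recr !big_ord0 /=; lra.
rewrite ltnS => /IH {}IH; rewrite !big_ord_recr /= -[M.+1%:R]natr1.
set S := \sum_(r < M) a r in IH *; set Q := \sum_(r < M) _ in IH *.
have : 0 <= \sum_(r < M) (a r - a M) ^+ 2 by apply: sumr_ge0 => r _; exact: sqr_ge0.
have -> : \sum_(r < M) (a r - a M) ^+ 2 = Q - 2 * a M * S + M%:R * a M ^+ 2.
  rewrite (eq_bigr (fun r : 'I_M => (a r ^+ 2 - 2 * a M * a r) + a M ^+ 2)); last by move=> r _; ring.
  by rewrite big_split sumrB -mulr_sumr sumr_const card_ord -[_ *+ M]mulr_natl.
lra.
Qed.

(** A difference of step M w is a sum of M differences of step w; the retained gap of two neighbours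
    is the second difference. *)
Lemma energy_drop w g M : (2 <= M)%N ->
  \sum_x fdiff (w *+ M) g x ^+ 2 + \sum_x fdiff w (fdiff w g) x ^+ 2 <=
  M%:R ^+ 2 * \sum_x fdiff w g x ^+ 2.
Proof.
move=> M2.
have tele x : fdiff (w *+ M) g x = \sum_(r < M) fdiff w g (x + w *+ r).
  transitivity (\sum_(0 <= r < M) (g (x + w *+ r.+1) - g (x + w *+ r))).
    by rewrite telescope_sumr// mulr0n addr0.
  by rewrite big_mkord; apply: eq_bigr => r _; rewrite /fdiff mulrSr addrA.
apply: (@le_trans _ _ (\sum_x M%:R * \sum_(r < M) fdiff w g (x + w *+ r) ^+ 2)).
  rewrite -big_split; apply: ler_sum => x _ /=.
  rewrite tele {3}/fdiff; have := sqr_sum_gap (fun r => fdiff w g (x + w *+ r)) M2.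
  by rewrite mulr1n mulr0n addr0.
rewrite -mulr_sumr exchange_big /= expr2 -mulrA ler_wpM2l//.
under eq_bigr => r _ do rewrite (sum_shift (w *+ r) (fun x => fdiff w g x ^+ 2)).
by rewrite sumr_const card_ord mulr_natl.
Qed.

Lemma exists_le_mean (a : nat -> R) (N0 N : nat) (S : R) : (N0 < N)%N ->
  \sum_(N0 <= i < N) a i <= S ->
  exists2 i, (N0 <= i < N)%N & a i <= S / (N - N0)%:R.
Proof.
move=> NN aS.
have NR : 0 < (N - N0)%:R :> R by rewrite ltr0n subn_gt0.
have [/hasP[i]|/hasPn no] := boolP (has (fun i => a i <= S / (N - N0)%:R) (index_iota N0 N)).
  by rewrite mem_index_iota => iN ai; exists i.
have : \sum_(N0 <= i < N) (S / (N - N0)%:R) < \sum_(N0 <= i < N) a i.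
  apply: ltr_sum_nat => // i iN; rewrite ltNge; apply: no.
  by rewrite mem_index_iota.
rewrite sumr_const_nat -[_ *+ _]mulr_natr divfK ?gt_eqF//; lra.
Qed.

Lemma card_markov (P : pred T) f (c : R) : 0 < c -> (forall x, 0 <= f x) ->
  (forall x, P x -> c <= f x) -> #|P|%:R * c <= \sum_x f x.
Proof.
move=> c0 f0 Pf; rewrite (bigID P)/= -[leLHS]addr0 lerD ?sumr_ge0//.
by rewrite mulr_natl -sumr_const ler_sum.
Qed.

Variables (k m M : nat) (e : 'I_k -> T) (g : 'I_m -> T -> R) (Fs : nat -> {set T}) (eta delta : R).

(** The level i counts refinements of the cubes, whereas steps are counted on the finest grid: level
    i + 1 has step M^(N - i - 1). The factor M^(N - i - 1) eta is the Lipschitz bound for a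
    difference of that step. *)
Definition bad_points (N i : nat) : {set T} :=
  let w j := e j *+ M ^ (N - i.+1) in
  (Fs i :\: Fs i.+1) :|:
  [set x | [exists l, exists j1, exists j2,
     delta * ((M ^ (N - i.+1))%:R * eta) < `|fdiff (w j1) (fdiff (w j2) (g l)) x|]].

(* The energies M^(-2s) sum |fdiff (M^s e_j) g|^2 decrease in s and the second differences
   are dominated by the drop from s to s + 1; summing all drops over the scales
   together with the drops of the decreasing family Fs, one scale has a small drop. *)
Lemma few_bad_points (N0 N : nat) : (2 <= M)%N -> (N0 < N)%N -> 0 < eta -> 0 < delta ->
  (forall l j x, `|fdiff (e j) (g l) x| <= eta) -> (forall i, (i < N)%N -> Fs i.+1 \subset Fs i) ->
  exists2 i, (N0 <= i < N)%N &
    #|bad_points N i|%:R <=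
      #|T|%:R * (1 + m%:R * k%:R ^+ 2 * M%:R ^+ 2 / delta ^+ 2) / (N - N0)%:R.
Proof.
move=> M2 NN eta0 delta0 lip Fdec.
have M0 : 0 < M%:R :> R by rewrite ltr0n; lia.
pose w s j := e j *+ M ^ s.
pose E s := \sum_(l < m) \sum_(j < k) \sum_x fdiff (w s j) (g l) x ^+ 2.
pose SD s := \sum_(l < m) \sum_(j < k) \sum_x fdiff (w s j) (fdiff (w s j) (g l)) x ^+ 2.
have SD0 s : 0 <= SD s by do 3 (apply: sumr_ge0 => ? _); exact: sqr_ge0.
have E0 s : 0 <= E s by do 3 (apply: sumr_ge0 => ? _); exact: sqr_ge0.
have drop s : E s.+1 + SD s <= M%:R ^+ 2 * E s.
  rewrite /E /SD -big_split mulr_sumr; apply: ler_sum => l _.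
  rewrite -big_split mulr_sumr; apply: ler_sum => j _.
  by rewrite /w expnSr mulrnA; exact: energy_drop.
pose a s := SD s / M%:R ^+ (2 * s.+1).
have sum_a n : \sum_(s < n) a s <= E 0%N - E n / M%:R ^+ (2 * n).
  elim: n => [|n IH]; first by rewrite big_ord0 expr0 divr1 subrr.
  rewrite big_ord_recr /=.
  have : E n.+1 / M%:R ^+ (2 * n.+1) + a n <= E n / M%:R ^+ (2 * n).
    rewrite /a -mulrDl mulnS exprD ler_pdivrMr ?mulr_gt0 ?exprn_gt0//.
    apply: (le_trans (drop n)); rewrite le_eqVlt; apply/orP; left; apply/eqP.
    by field; rewrite expf_neq0 ?lt0r_neq0.
  lra.
have {}sum_a n : \sum_(s < n) a s <= m%:R * k%:R * #|T|%:R * eta ^+ 2.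
  apply: (le_trans (sum_a n)); apply: (@le_trans _ _ (E 0%N)).
    by rewrite gerBl divr_ge0// exprn_ge0// ltW.
  apply: (@le_trans _ _ (\sum_(l < m) \sum_(j < k) \sum_(x : T) eta ^+ 2)).
    do 3 (apply: ler_sum => ? _); rewrite -[leLHS]real_normK ?num_real//.
    by rewrite lerXn2r ?nnegrE// ?(ltW eta0)// /w expn0 mulr1n.
  by rewrite !sumr_const !card_ord -!mulrnA -[leLHS]mulr_natl !natrM; lra.
(* The Markov constant: k for passing from mixed to pure differences, M^2 for the exponent s + 1 in
   [a], and the square of the threshold with its factor M^(2 s) cancelled. *)
pose C := k%:R * M%:R ^+ 2 / (delta * eta) ^+ 2.
have C0 : 0 <= C by rewrite divr_ge0 ?sqr_ge0// mulr_ge0 ?sqr_ge0.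
pose f i := #|Fs i :\: Fs i.+1|%:R + C * a (N - i.+1)%N.
have sum_f : \sum_(N0 <= i < N) f i <= #|T|%:R * (1 + m%:R * k%:R ^+ 2 * M%:R ^+ 2 / delta ^+ 2).
  rewrite /f big_split mulrDr mulr1 /=; apply: lerD.
    have : forall n, (N0 + n <= N ->
        \sum_(N0 <= i < N0 + n) #|Fs i :\: Fs i.+1| + #|Fs (N0 + n)| <= #|Fs N0|)%N.
      elim => [|n IH]; first by rewrite addn0 big_geq.
      rewrite addnS => nN; have {}IH := IH (ltnW nN).
      rewrite big_nat_recr ?leq_addr//= -addnA.
      have -> // : (#|Fs (N0 + n) :\: Fs (N0 + n).+1| + #|Fs (N0 + n).+1| = #|Fs (N0 + n)|)%N.
      by rewrite -(cardsID (Fs (N0 + n).+1) (Fs (N0 + n))) addnC (finset.setIidPr (Fdec _ nN)).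
    move=> /(_ (N - N0)%N); rewrite subnKC ?(ltnW NN)// => /(_ (leqnn _)) H.
    rewrite -natr_sum ler_nat; apply: leq_trans (max_card (mem (Fs N0))).
    by apply: leq_trans H; exact: leq_addr.
  rewrite -mulr_sumr.
  have -> : \sum_(N0 <= i < N) a (N - i.+1)%N = \sum_(s < N - N0) a s.
    rewrite big_nat_rev /= -{1}[N0]add0n big_addn big_mkord; apply: eq_bigr => i _.
    by congr (a _); have := ltn_ord i; lia.
  apply: (le_trans (ler_wpM2l C0 (sum_a _))); rewrite le_eqVlt; apply/orP; left; apply/eqP.
  by rewrite /C; field; rewrite !lt0r_neq0.
have [i iN fi] := exists_le_mean NN sum_f; exists i => //; apply: le_trans fi.
apply: (@le_trans _ _ (#|Fs i :\: Fs i.+1| + #|[set x | [exists l, exists j1, exists j2,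
     delta * ((M ^ (N - i.+1))%:R * eta) <
     `|fdiff (w (N - i.+1)%N j1) (fdiff (w (N - i.+1)%N j2) (g l)) x|]]|)%:R).
  by rewrite ler_nat /bad_points cardsU leq_subr.
rewrite natrD /f lerD2l; set s := (N - i.+1)%N; set P := [set x | _].
pose h := delta * ((M ^ s)%:R * eta).
have h0 : 0 < h by rewrite !mulr_gt0// natrX exprn_gt0.
pose mix x := \sum_(l < m) \sum_(j1 < k) \sum_(j2 < k) fdiff (w s j1) (fdiff (w s j2) (g l)) x ^+ 2.
have : #|P|%:R * h ^+ 2 <= \sum_x mix x.
  apply: (card_markov (P := mem P)); first by rewrite exprn_gt0.
    by move=> x; do 3 (apply: sumr_ge0 => ? _); exact: sqr_ge0.
  move=> x xP; have : x \in P by []; rewrite finset.in_set => /existsP[l] /existsP[j1] /existsP[j2] hlt.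
  apply: (@le_trans _ _ (fdiff (w s j1) (fdiff (w s j2) (g l)) x ^+ 2)).
    rewrite -[leRHS]real_normK ?num_real// lerXn2r ?nnegrE//; last exact: ltW.
    exact: ltW.
  rewrite /mix (bigD1 l)//= (bigD1 j1)//= (bigD1 j2)//= -!addrA lerDl.
  by rewrite !addr_ge0//; do ?(apply: sumr_ge0 => ? _); exact: sqr_ge0.
have mixSD : \sum_x mix x <= k%:R * SD s.
  rewrite /mix exchange_big /SD mulr_sumr; apply: ler_sum => l _ /=.
  rewrite exchange_big /=; under eq_bigr do rewrite exchange_big /=.
  set q := fun j => \sum_x fdiff (w s j) (fdiff (w s j) (g l)) x ^+ 2.
  apply: (@le_trans _ _ (\sum_(j1 < k) \sum_(j2 < k) (q j1 + q j2) / 2)).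
    by apply: ler_sum => j1 _; apply: ler_sum => j2 _; exact: mixed_energy_le.
  rewrite le_eqVlt; apply/orP; left; apply/eqP.
  transitivity (\sum_(j1 < k) (k%:R * q j1 + \sum_j2 q j2) / 2).
    apply: eq_bigr => j1 _; rewrite -mulr_suml big_split /= sumr_const card_ord.
    by rewrite -[_ *+ k]mulr_natl.
  rewrite -mulr_suml big_split /= -mulr_sumr sumr_const card_ord -[_ *+ k]mulr_natl.
  by rewrite -/q; field.
move=> markov; rewrite -(ler_pM2r (_ : 0 < h ^+ 2)) ?exprn_gt0//.
apply: (le_trans markov); apply: (le_trans mixSD).
rewrite le_eqVlt; apply/orP; left; apply/eqP.
rewrite /C /a /h mulnS exprD mulnC exprM !natrX; field.
by rewrite expf_neq0 !lt0r_neq0.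
Qed.
End FiniteDifferences.

(** * Lipschitz extension and discrete affine approximation *)

Section McShane.
Context {R : realType} {k : nat}.
Notation V := ('rV[R]_k).

(** The extension is the infimum over y in E of phi y + B |x - y|; an empty [E] is treated apart, to
    keep the infimum meaningful. *)
Lemma mcshane (E : set V) (phi : V -> R) (B : R) : 0 <= B ->
  (forall x y, E x -> E y -> `|phi x - phi y| <= B * `|x - y|) ->
  exists u : V -> R, (forall x, E x -> u x = phi x) /\
    forall x y, `|u x - u y| <= B * `|x - y|.
Proof.
move=> B0 lip; have [[y0 Ey0]|E0] := pselect (exists y, E y); last first.
  exists (fun=> 0); split=> [x Ex|x y]; first by case: E0; exists x.
  by rewrite subrr normr0 mulr_ge0.
pose S x := [set phi y + B * `|x - y| | y in E].
have lbS x y : E y -> phi y0 - B * `|x - y0| <= phi y + B * `|x - y|.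
  move=> Ey; have := lip _ _ Ey Ey0; rewrite ler_norml => /andP[lo _].
  have : `|y - y0| <= `|x - y| + `|x - y0|.
    by rewrite (distrC x y); exact: ler_distD.
  nra.
have hS x : has_inf (S x).
  split; first by exists (phi y0 + B * `|x - y0|), y0.
  by exists (phi y0 - B * `|x - y0|) => _ [y Ey <-]; exact: lbS.
have infle x y : E y -> inf (S x) <= phi y + B * `|x - y|.
  by move=> Ey; apply: ge_inf; [case: (hS x)|exists y].
have half x y : inf (S x) <= inf (S y) + B * `|x - y|.
  rewrite -lerBlDr; apply: lb_le_inf; first by case: (hS y).
  move=> _ [z Ez <-]; rewrite lerBlDr; apply: (le_trans (infle x z Ez)).
  have : `|x - z| <= `|y - z| + `|x - y| by rewrite [leRHS]addrC; exact: ler_distD.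
  nra.
exists (fun x => inf (S x)); split=> [x Ex|x y].
  apply/eqP; rewrite eq_le; apply/andP; split.
    by apply: (le_trans (infle x x Ex)); rewrite subrr normr0 mulr0 addr0.
  apply: lb_le_inf; first by case: (hS x).
  move=> _ [z Ez <-]; have := lip _ _ Ex Ez; rewrite ler_norml => /andP[_]; lra.
by rewrite ler_norml; have := half x y; have := half y x; rewrite (distrC y x) => ? ?;
  apply/andP; split; lra.
Qed.
End McShane.

(** * Discrete functions with small mixed second differences *)

Section ApproxAffine.
Context {R : realType} {k : nat}.

Definition bump_at (i : 'I_k) (m : nat) (b : 'I_k -> nat) : 'I_k -> nat :=
  fun l => (b l + (l == i) * m)%N.

Lemma bump_at_pred (b : 'I_k -> nat) i : (0 < b i)%N ->
  exists2 b', b = bump_at i 1 b' & forall l, (b' l <= b l)%N.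
Proof.
move=> bi; exists (fun l => b l - (l == i))%N; last by move=> l; exact: leq_subr.
by apply/funext => l; rewrite /bump_at muln1; case: eqP => [->|_]; rewrite ?subn0 ?addn0// subnK.
Qed.

Lemma sum_bump_at i (b : 'I_k -> nat) : (\sum_l bump_at i 1 b l = (\sum_l b l).+1)%N.
Proof.
rewrite /bump_at big_split /= -[RHS]addn1; congr (_ + _)%N.
by rewrite (bigD1 i)//= big1 ?eqxx// => l /negbTE ->.
Qed.

(** Walk from the origin to b by unit steps, at most k M of them. After m steps each slope has
    changed by at most m d, and these errors add up to at most (k M)^2 d. *)
Lemma approx_affine (G : ('I_k -> nat) -> R) (M : nat) (d : R) : 0 <= d ->
  (forall b i j, (forall l, b l < M)%N ->
    `|G (bump_at i 1 (bump_at j 1 b)) - G (bump_at i 1 b) - G (bump_at j 1 b) + G b| <= d) ->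
  forall b, (forall l, b l < M)%N ->
    `|G b - G (fun=> 0%N) - \sum_i (b i)%:R * (G (bump_at i 1 (fun=> 0%N)) - G (fun=> 0%N))|
      <= (k * M)%:R ^+ 2 * d.
Proof.
move=> d0 mixed; pose o : 'I_k -> nat := fun=> 0%N.
have zero b : (\sum_l b l = 0)%N -> b = o.
  by move=> /eqP; rewrite sum_nat_eq0 => /forallP H; apply/funext => l; apply/eqP/H.
have pos b : (0 < \sum_l b l)%N -> exists i, (0 < b i)%N.
  move=> b0; apply/not_existsP => H; move: b0; rewrite big1// => i _.
  by apply/eqP; rewrite -leqn0 leqNgt; apply/negP => /H.
have slope m b j : (\sum_l b l = m)%N -> (forall l, b l < M)%N ->
    `|(G (bump_at j 1 b) - G b) - (G (bump_at j 1 o) - G o)| <= m%:R * d.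
  elim: m b => [b /zero -> _|m IH b bm bM]; first by rewrite subrr normr0 mul0r.
  have [i /bump_at_pred[b' bE b'b]] : exists i, (0 < b i)%N by apply: pos; rewrite bm.
  have b'M l : (b' l < M)%N by apply: leq_ltn_trans (bM l).
  have b'm : (\sum_l b' l = m)%N by move: bm; rewrite bE sum_bump_at => -[].
  have := IH _ b'm b'M; have := mixed b' j i b'M; rewrite -bE.
  set x := G (bump_at j 1 b); set y := G b; set z := G (bump_at j 1 b'); set t := G b'.
  set s := _ - G o; rewrite -natr1 mulrDl mul1r !ler_norml => /andP[? ?] /andP[? ?].
  by apply/andP; split; lra.
suff main m b : (\sum_l b l = m)%N -> (forall l, b l < M)%N ->
    `|G b - G o - \sum_i (b i)%:R * (G (bump_at i 1 o) - G o)| <= m%:R ^+ 2 * d.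
  move=> b bM; apply: (le_trans (main _ b erefl bM)).
  rewrite ler_wpM2r// lerXn2r ?nnegrE// ler_nat -[k in (_ <= k * M)%N]card_ord -sum_nat_const.
  by apply: leq_sum => l _; exact: ltnW.
elim: m b => [b /zero -> _|m IH b bm bM].
  by rewrite subrr big1 ?subr0 ?normr0 ?mulr_ge0 ?sqr_ge0// => i _; rewrite mul0r.
have [i /bump_at_pred[b' bE b'b]] : exists i, (0 < b i)%N by apply: pos; rewrite bm.
have b'M l : (b' l < M)%N by apply: leq_ltn_trans (bM l).
have b'm : (\sum_l b' l = m)%N by move: bm; rewrite bE sum_bump_at => -[].
have h1 := slope m b' i b'm b'M; have h2 := IH _ b'm b'M.
have -> : \sum_l (b l)%:R * (G (bump_at l 1 o) - G o) =
    \sum_l (b' l)%:R * (G (bump_at l 1 o) - G o) + (G (bump_at i 1 o) - G o).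
  rewrite [in RHS](bigD1 i)//= (bigD1 i)//= bE {1}/bump_at eqxx mul1n natrD mulrDl mul1r addrAC.
  congr (_ + _ + _); apply: eq_bigr => l /negbTE li.
  by rewrite /bump_at li mul0n addn0.
rewrite -bE in h1; move: h1 h2; set u := \sum_l _; set v := G (bump_at i 1 o) - G o.
rewrite -natr1 !ler_norml => /andP[? ?] /andP[? ?].
have m0 : 0 <= m%:R * d by rewrite mulr_ge0.
by apply/andP; split; nra.
Qed.
End ApproxAffine.

(** * Folding a discrete torus onto the unit cube *)

Section Torus.
Context {R : realType} {k : nat}.
Variables (p L : nat).
Hypothesis pL : p.+1 = (2 * L)%N.
Notation torus := ('rV['I_p.+1]_k).

Let L0 : (0 < L)%N. Proof. by case: L pL => //; rewrite muln0. Qed.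

Definition torus_pt (c : 'I_k -> nat) : torus := \row_l inZp (c l).

Definition torus_unit (i : 'I_k) : torus := torus_pt (fun l => l == i).

(* Folding the circle of length 2 onto [0, 1] makes every function on the unit
   cube periodic without losing its Lipschitz constant. *)
Definition fold_pos (x : torus) : 'rV[R]_k :=
  \row_l ((minn (x ord0 l) (2 * L - x ord0 l))%:R / L%:R).

Lemma torus_ptD c i m : torus_pt c + torus_unit i *+ m = torus_pt (bump_at i m c).
Proof.
have inZpD a b : inZp a + inZp b = inZp (a + b) :> 'I_p.+1.
  by apply/val_inj; rewrite /= modnDm.
have -> : torus_unit i *+ m = torus_pt (fun l => (l == i) * m)%N.
  elim: m => [|m IH].
    by apply/rowP => l; rewrite !mxE muln0; apply/val_inj; rewrite /= mod0n.
  by rewrite mulrS IH; apply/rowP => l; rewrite !mxE inZpD mulnS.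
by apply/rowP => l; rewrite !mxE inZpD.
Qed.

Lemma fold_pos_pt c : (forall l, c l < L)%N -> fold_pos (torus_pt c) = \row_l ((c l)%:R / L%:R).
Proof.
move=> cL; apply/rowP => l; rewrite !mxE /=; congr (_%:R / _).
by have := cL l => cl; rewrite modn_small ?pL; lia.
Qed.

Lemma fold_pos_lip x i : `|fold_pos (x + torus_unit i) - fold_pos x| <= L%:R^-1.
Proof.
have LR : 0 < L%:R :> R by rewrite ltr0n.
rewrite [leLHS]/Num.norm/= mx_normrE; apply: bigmax_le; first by rewrite invr_ge0 ltW.
move=> -[z l] _ /=; rewrite (ord1 z) !mxE /= -mulrBl normrM normfV (gtr0_norm LR).
rewrite -[leRHS]mul1r ler_pM2r ?invr_gt0//.
set a := (minn _ _ in X in `|X - _|); set b := minn _ _.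
have [ab ba] : (a <= b.+1 /\ b <= a.+1)%N.
  rewrite /a /b modnDmr; have := ltn_ord (x ord0 l); move: (nat_of_ord _) => y.
  rewrite pL => yL; case: (l == i) => /=; last by rewrite addn0 modn_small//; lia.
  have [yE|yne] := eqVneq y.+1 (2 * L)%N; last by rewrite addn1 modn_small; lia.
  by rewrite addn1 yE modnn; lia.
move: ab ba; rewrite -!(ler_nat R) -[b.+1%:R]natr1 -[a.+1%:R]natr1 => ab ba.
by rewrite ler_norml; apply/andP; split; lra.
Qed.
End Torus.

(** * Covering at a well chosen scale *)

Section Cells.
Context {R : realType} {k : nat}.
Implicit Types (c : 'I_k -> nat) (x y : 'rV[R]_k).

Definition in_cell (K : nat) c x :=
  forall l, (c l)%:R <= K%:R * x ord0 l < (c l).+1%:R.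

Lemma in_cell_dist (K a : nat) c c' x y : (0 < K)%N -> in_cell K c x -> in_cell K c' y ->
  (forall l, c l <= c' l + a /\ c' l <= c l + a)%N -> `|x - y| <= a.+1%:R / K%:R.
Proof.
move=> K0 cx c'y ca; have KR : 0 < K%:R :> R by rewrite ltr0n.
rewrite [leLHS]/Num.norm/= mx_normrE; apply: bigmax_le; first by rewrite divr_ge0.
move=> -[i l] _ /=; rewrite (ord1 i) !mxE ler_pdivlMr// -[X in _ * X](ger0_norm (ltW KR)).
rewrite -normrM; have [h1 h2] := ca l; have := cx l; have := c'y l.
move: h1 h2; rewrite -!(ler_nat R) !natrD -[(c l).+1%:R]natr1 -[(c' l).+1%:R]natr1 -[a.+1%:R]natr1.
move=> ? ? /andP[? ?] /andP[? ?]; rewrite ler_norml; apply/andP; split; lra.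
Qed.

Lemma in_cell_div (K M : nat) c x : (0 < M)%N -> in_cell (K * M) c x ->
  in_cell K (fun l => c l %/ M)%N x.
Proof.
move=> M0 cx l; have MR : 0 < M%:R :> R by rewrite ltr0n.
have /andP[lo hi] := cx l; rewrite natrM in lo hi.
have h1 : (c l %/ M * M <= c l)%N by exact: leq_trunc_div.
have h2 : ((c l).+1 <= (c l %/ M).+1 * M)%N by rewrite ltn_ceil.
move: h1 h2; rewrite -!(ler_nat R) => h1 h2.
by apply/andP; split; [rewrite -(ler_pM2r MR)|rewrite -(ltr_pM2r MR)]; rewrite -natrM; lra.
Qed.

Lemma in_cell_exists (K : nat) x : (0 < K)%N -> (forall l, 0 <= x ord0 l < 1) ->
  exists Q : {ffun 'I_k -> 'I_K}, in_cell K (fun l => Q l) x.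
Proof.
move=> K0 x01; have KR : 0 < K%:R :> R by rewrite ltr0n.
have tr l : (Num.truncn (K%:R * x ord0 l) < K)%N.
  have /andP[x0 x1] := x01 l; have Kx0 : 0 <= K%:R * x ord0 l by rewrite mulr_ge0// ltW.
  rewrite -(ltr_nat R); have /andP[+ _] := truncn_itv Kx0 => /le_lt_trans; apply.
  by rewrite gtr_pMr.
exists [ffun l => Ordinal (tr l)] => l; rewrite ffunE /=; apply: truncn_itv.
by have /andP[x0 x1] := x01 l; rewrite mulr_ge0// ltW.
Qed.

Lemma in_cell_uniq (K : nat) c c' x : in_cell K c x -> in_cell K c' x -> c = c'.
Proof.
move=> cx c'x; apply/funext => l; have /andP[a1 a2] := cx l; have /andP[b1 b2] := c'x l.
have h1 : (c l < (c' l).+1)%N by rewrite -(ltr_nat R) (le_lt_trans a1).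
have h2 : (c' l < (c l).+1)%N by rewrite -(ltr_nat R) (le_lt_trans b1).
by apply/eqP; rewrite eqn_leq; apply/andP.
Qed.

End Cells.

Section SubCells.
Local Close Scope classical_set_scope.
Context {R : realType} {k : nat}.

(** A three-digit index on the finest grid: cube [Q], cell [b] in the cube, position [t] in the
    cell. For fixed [t] and varying [b] it runs through a translate of the grid of step [S]. *)
Definition subcell (M S : nat) (Q b t : 'I_k -> nat) : 'I_k -> nat :=
  fun l => ((Q l * M + b l) * S + t l)%N.

Lemma subcell_div M S Q b t : (forall l, t l < S)%N ->
  forall l, (subcell M S Q b t l %/ S)%N = (Q l * M + b l)%N.
Proof.
move=> tS l; have S0 : (0 < S)%N by apply: leq_ltn_trans (tS l).
by rewrite /subcell divnMDl// divn_small ?addn0.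
Qed.

Lemma subcell_div2 M S Q b t : (forall l, t l < S)%N -> (forall l, b l < M)%N ->
  forall l, (subcell M S Q b t l %/ (S * M))%N = Q l.
Proof.
move=> tS bM l; have M0 : (0 < M)%N by apply: leq_ltn_trans (bM l).
by rewrite divnMA subcell_div// divnMDl// divn_small ?addn0.
Qed.

Lemma subcell_mod M S Q b t : (forall l, t l < S)%N ->
  forall l, (subcell M S Q b t l %% S)%N = t l.
Proof. by move=> tS l; rewrite /subcell modnMDl modn_small. Qed.

Lemma subcell_lt M S G Q b t : (forall l, t l < S)%N -> (forall l, b l < M)%N ->
  (forall l, Q l < G)%N -> forall l, (subcell M S Q b t l < G * M * S)%N.
Proof.
move=> tS bM QG l; rewrite /subcell; have := tS l; have := bM l; have := QG l.
move: (Q l) (b l) (t l) => q b' t' qG b'M t'S.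
apply: (@leq_trans ((q * M + b').+1 * S)); first by rewrite mulSn addnC ltn_add2r.
rewrite leq_mul2r; apply/orP; right.
apply: (@leq_trans (q.+1 * M)); first by rewrite mulSn addnC ltn_add2r.
by rewrite leq_mul2r qG orbT.
Qed.

Lemma subcell_bump M S Q b t i :
  subcell M S Q (bump_at i 1 b) t = bump_at i S (subcell M S Q b t).
Proof. by apply/funext => l; rewrite /subcell /bump_at; case: (l == i) => /=; nia. Qed.

Definition nats K (q : {ffun 'I_k -> 'I_K}) : 'I_k -> nat := fun l => q l.

Lemma nats_lt K (q : {ffun 'I_k -> 'I_K}) l : (nats q l < K)%N.
Proof. exact: ltn_ord. Qed.

(** A cube is counted only if every offset [t] meets a bad point. Choosing one such point for each
    offset gives S^k points per cube; they are all distinct because Q and t are digits of the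
    index. *)
Lemma card_bad_cubes (p G M S : nat) (bad : {set 'rV['I_p.+1]_k}) : (G * M * S <= p.+1)%N ->
  (#|[set Q : {ffun 'I_k -> 'I_G} | [forall t : {ffun 'I_k -> 'I_S},
      exists b : {ffun 'I_k -> 'I_M}, torus_pt p (subcell M S (nats Q) (nats b) (nats t)) \in bad]]| * S ^ k
   <= #|bad|)%N.
Proof.
move=> Gp; set BQ := [set Q | _].
pose pick (Qt : {ffun 'I_k -> 'I_G} * {ffun 'I_k -> 'I_S}) : option {ffun 'I_k -> 'I_M} :=
  [pick b : {ffun 'I_k -> 'I_M} | torus_pt p (subcell M S (nats Qt.1) (nats b) (nats Qt.2)) \in bad].
pose phi Qt := if pick Qt is Some b then torus_pt p (subcell M S (nats Qt.1) (nats b) (nats Qt.2)) else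
  torus_pt p (fun=> 0%N).
have phiE Qt : Qt.1 \in BQ -> exists b : {ffun 'I_k -> 'I_M},
    phi Qt = torus_pt p (subcell M S (nats Qt.1) (nats b) (nats Qt.2)) /\ phi Qt \in bad.
  rewrite inE => /forallP/(_ Qt.2)/existsP[b0 b0bad].
  rewrite /phi /pick; case: pickP => [b bbad|/(_ b0)]; first by exists b.
  by rewrite b0bad.
have -> : (#|BQ| * S ^ k = #|finset.setX BQ [set: {ffun 'I_k -> 'I_S}]|)%N.
  by rewrite cardsX cardsT card_ffun !card_ord.
have inj : {in finset.setX BQ [set: {ffun 'I_k -> 'I_S}] &, injective phi}.
  move=> [Q t] [Q' t'] /finset.setXP[QB _] /finset.setXP[Q'B _].
  have [b [-> _]] := phiE (Q, t) QB; have [b' [-> _]] := phiE (Q', t') Q'B.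
  rewrite /= => /rowP HE.
  have {}HE : subcell M S (nats Q) (nats b) (nats t) = subcell M S (nats Q') (nats b') (nats t').
    apply/funext => l; have := HE l; rewrite !mxE => /(congr1 val) /=.
    have small (q : {ffun 'I_k -> 'I_G}) (u : {ffun 'I_k -> 'I_M}) (v : {ffun 'I_k -> 'I_S}) :
        (subcell M S (nats q) (nats u) (nats v) l < p.+1)%N.
      by apply: leq_trans Gp; apply: subcell_lt; exact: nats_lt.
    by rewrite !modn_small.
  congr (_, _); apply/ffunP => l; apply/val_inj => /=.
    rewrite -[LHS](@subcell_div2 M S (nats Q) (nats b) (nats t) (nats_lt _) (nats_lt _)) HE.
    by rewrite subcell_div2 //; exact: nats_lt.
  rewrite -[LHS](@subcell_mod M S (nats Q) (nats b) (nats t) (nats_lt _)) HE.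
  by rewrite subcell_mod //; exact: nats_lt.
rewrite -(card_in_imset inj); apply: subset_leq_card; apply/fintype.subsetP => y /imsetP[Qt].
by case: Qt => Q t /finset.setXP[QB _] ->; have [b []] := phiE (Q, t) QB.
Qed.
End SubCells.

(** * Covering the image of a subset of the unit cube *)

Section UnitCube.
Context {R : realType} {n k : nat}.
Hypotheses (n0 : (0 < n)%N) (nk : (n < k)%N).
Notation zn := ('rV[R]_n * 'rV[R]_n)%type.
Notation heisn := (heis R n).
Variables (E : set 'rV[R]_k) (f : 'rV[R]_k -> heisn) (B : R).
Hypothesis (B1 : 1 <= B).
Hypothesis E01 : forall x, E x -> forall l, 0 <= x ord0 l < 1.
Hypothesis fz : forall x y, E x -> E y -> `|(f x).1 - (f y).1| <= B * `|x - y|.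
Hypothesis ftau : forall x y, E x -> E y -> `|tau (f x) (f y)| <= B * `|x - y| ^+ 2.
Hypothesis fd : forall x y, E x -> E y -> (dcc (f x) (f y) <= (B * `|x - y|)%:E)%E.

Definition zcoord (l : 'I_(n + n)) (z : zn) : R :=
  match fintype.split l with inl j => z.1 ord0 j | inr j => z.2 ord0 j end.

Lemma zcoord_lshift j z : zcoord (lshift n j) z = z.1 ord0 j.
Proof. by rewrite /zcoord -[lshift n j]/(unsplit (inl j)) unsplitK. Qed.

Lemma zcoord_rshift j z : zcoord (rshift n j) z = z.2 ord0 j.
Proof. by rewrite /zcoord -[rshift n j]/(unsplit (inr j)) unsplitK. Qed.

Lemma znorm_le (z : zn) (c : R) : 0 <= c -> (forall l, `|zcoord l z| <= c) -> `|z| <= c.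
Proof.
move=> c0 H; rewrite prod_normE ge_max; apply/andP; split;
  rewrite [leLHS]/Num.norm/= mx_normrE; apply: bigmax_le => // -[i j] _ /=; rewrite (ord1 i).
  by have := H (lshift n j); rewrite zcoord_lshift.
by have := H (rshift n j); rewrite zcoord_rshift.
Qed.

Lemma zcoord_le l z : `|zcoord l z| <= `|z|.
Proof.
rewrite prod_normE le_max /zcoord; apply/orP; case: (fintype.split l) => j; [left|right];
  by rewrite [leRHS]/Num.norm/= mx_normrE; apply: (le_bigmax _ _ (ord0, j)).
Qed.

Lemma zcoordB l z z' : zcoord l (z - z') = zcoord l z - zcoord l z'.
Proof. by rewrite /zcoord; case: (fintype.split l) => j; rewrite !mxE. Qed.

Lemma zcoord_sum l (c : 'I_k -> R) (D : 'I_k -> zn) :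
  zcoord l (\sum_i c i *: D i) = \sum_i c i * zcoord l (D i).
Proof.
rewrite /zcoord; case: (fintype.split l) => j.
  rewrite (@big_morph _ _ (fun a : zn => a.1 ord0 j) 0 +%R 0 +%R) ?mxE//.
    by apply: eq_bigr => i _; rewrite !mxE.
  by move=> x y; rewrite mxE.
rewrite (@big_morph _ _ (fun a : zn => a.2 ord0 j) 0 +%R 0 +%R) ?mxE//.
  by apply: eq_bigr => i _; rewrite !mxE.
by move=> x y; rewrite mxE.
Qed.

Lemma z_extension : exists U : 'rV[R]_k -> zn, (forall x, E x -> U x = (f x).1) /\
  forall x y, `|U x - U y| <= B * `|x - y|.
Proof.
have B0 : 0 <= B by apply: le_trans B1.
have /choice[u Hu] l : exists u : 'rV[R]_k -> R, (forall x, E x -> u x = zcoord l (f x).1) /\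
    forall x y, `|u x - u y| <= B * `|x - y|.
  apply: mcshane => // x y Ex Ey; rewrite -zcoordB.
  exact: le_trans (zcoord_le _ _) (fz Ex Ey).
exists (fun x => (\row_j u (lshift n j) x, \row_j u (rshift n j) x)); split=> [x Ex|x y].
  rewrite [(f x).1]surjective_pairing; congr (_, _); apply/rowP => j; rewrite mxE.
    by have [-> //] := Hu (lshift n j); rewrite zcoord_lshift.
  by have [-> //] := Hu (rshift n j); rewrite zcoord_rshift.
apply: znorm_le => [|l]; first by rewrite mulr_ge0.
rewrite zcoordB; case: (split_ordP l) => j ->; rewrite ?zcoord_lshift ?zcoord_rshift !mxE.
  by have [_] := Hu (lshift n j); apply.
by have [_] := Hu (rshift n j); apply.
Qed.

Section Scale.
Local Close Scope classical_set_scope.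
Variables (r0 N g0 : nat).
Hypotheses (r02 : (2 <= r0)%N) (gN0 : (g0 < N)%N).
Notation M := (r0 ^ 2)%N.
Notation L := (M ^ N)%N.
Notation p := (2 * L).-1.

Let M2 : (2 <= M)%N. Proof. by rewrite -mulnn; nia. Qed.
Let M0 : (0 < M)%N. Proof. exact: leq_trans M2. Qed.
Let L0 : (0 < L)%N. Proof. by rewrite expn_gt0 M0. Qed.
Let pL : p.+1 = (2 * L)%N. Proof. by rewrite prednK// muln_gt0. Qed.
Let B0 : 0 < B. Proof. exact: lt_le_trans B1. Qed.
Let k0 : (0 < k)%N. Proof. exact: leq_ltn_trans nk. Qed.

(** The term 4 B comes from [tau] at distance at most 2 h between neighbouring cells, and 1 from the
    error h of the affine approximation. *)
Notation C := (4 * B + 1).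
Notation K := (cube_const n k C).
Notation keys := {ffun 'I_k.-1 -> 'I_((3 * r0).-1.+1)}.
Notation eta := (B / L%:R).
(** For the step S with h = S / L, the threshold delta (S eta) is h / (k M)^2, so that
    [approx_affine] gives an error of exactly h. *)
Notation delta := (((k * M)%:R ^+ 2 * B)^-1).

Variables (U : 'rV[R]_k -> zn).
Hypothesis UE : forall x, E x -> U x = (f x).1.
Hypothesis Ulip : forall x y, `|U x - U y| <= B * `|x - y|.

Definition fam (l : 'I_(n + n)) (x : 'rV['I_p.+1]_k) : R := zcoord l (U (fold_pos L x)).

Definition meets (K : nat) (c : 'I_k -> nat) : Prop := exists2 e, E e & in_cell K c e.

(** Restricted to the part of the torus with coordinates below L, where folding only rescales and a
    grid point lies in the cell of its index. *)
Definition met (i : nat) : {set 'rV['I_p.+1]_k} :=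
  [set x : 'rV['I_p.+1]_k | [forall l, x ord0 l < L]%N &&
    `[< meets (M ^ i) (fun l => x ord0 l %/ M ^ (N - i))%N >]].

Lemma met_dec i : (i < N)%N -> met i.+1 \subset met i.
Proof.
move=> iN; apply/fintype.subsetP => x; rewrite !inE => /andP[-> /asboolP[e Ee ce]] /=.
apply/asboolP; exists e => //.
have -> : (fun l => x ord0 l %/ M ^ (N - i))%N =
    (fun l => (x ord0 l %/ M ^ (N - i.+1)) %/ M)%N.
  by apply/funext => l; rewrite -divnMA -expnSr subnSK.
by apply: in_cell_div => //; rewrite -expnSr.
Qed.

Lemma fam_lip l j x : `|fdiff (torus_unit p j) (fam l) x| <= eta.
Proof.
rewrite /fdiff /fam -zcoordB; apply: (le_trans (zcoord_le _ _)); apply: (le_trans (Ulip _ _)).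
by rewrite ler_pM2l//; exact: fold_pos_lip.
Qed.

Section OneCube.
Variables (g : nat) (Q : 'I_k -> nat).
Hypotheses (gN : (g < N)%N) (QG : forall l, (Q l < M ^ g)%N).
Notation S := (M ^ (N - g.+1))%N.
Notation h := ((M ^ g.+1)%:R^-1 : R).
Notation bad := (bad_points M (torus_unit p) fam met eta delta N g).
(* The offset of a translate of the grid of step h that avoids the bad points of Q. *)
Variable t : 'I_k -> nat.
Hypothesis tS : forall l, (t l < S)%N.
Hypothesis good : forall b : 'I_k -> nat, (forall l, b l < M)%N ->
  torus_pt p (subcell M S Q b t) \notin bad.
Hypothesis Qmet : meets (M ^ g) Q.

Let LE : L = (M ^ g * M * S)%N.
Proof. by rewrite -expnSr -expnD subnKC. Qed.

Let G0 : (0 < M ^ g.+1)%N. Proof. by rewrite expn_gt0 M0. Qed.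

Let hE : h = S%:R / L%:R.
Proof.
rewrite LE -expnSr natrM invfM mulrCA mulfV ?mulr1//.
by rewrite pnatr_eq0 -lt0n expn_gt0 M0.
Qed.

Let cL b : (forall l, b l < M)%N -> forall l, (subcell M S Q b t l < L)%N.
Proof. by move=> bM l; rewrite LE; apply: subcell_lt. Qed.

Let P b := torus_pt p (subcell M S Q b t).

(** The point [P b] belongs to [met g] because [Q] meets [E]. Not being bad, it has not left the
    family at the next level, so its cell meets [E] as well. *)
Let Pmet b : (forall l, b l < M)%N -> meets (M ^ g.+1) (fun l => Q l * M + b l)%N.
Proof.
move=> bM.
have Pval l : (P b ord0 l = subcell M S Q b t l :> nat).
  by rewrite /P mxE /= modn_small// pL; have := cL bM l; lia.
have Pin i : (i <= N)%N -> (P b \in met i) = `[< meets (M ^ i)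
    (fun l => subcell M S Q b t l %/ M ^ (N - i))%N >].
  move=> iN; rewrite inE; have -> /= : [forall l, P b ord0 l < L]%N.
    by apply/forallP => l; rewrite Pval cL.
  by congr `[< meets _ _ >]; apply/funext => l; rewrite Pval.
have Pg : P b \in met g.
  rewrite Pin ?(ltnW gN)//; apply/asboolP.
  have -> // : (fun l => subcell M S Q b t l %/ M ^ (N - g))%N = Q.
  by apply/funext => l; rewrite -(subnSK gN) (expnSr M) subcell_div2.
have := good bM; rewrite finset.in_setU negb_or => /andP[+ _].
rewrite finset.in_setD -/(P b) Pg andbT negbK Pin// => /asboolP.
have -> // : (fun l => subcell M S Q b t l %/ M ^ (N - g.+1))%N = (fun l => Q l * M + b l)%N.
by apply/funext => l; rewrite subcell_div.
Qed.

Let Pmixed b : (forall l, b l < M)%N -> forall l i j,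
  `|fdiff (torus_unit p i *+ S) (fdiff (torus_unit p j *+ S) (fam l)) (P b)|
    <= delta * (S%:R * eta).
Proof.
move=> bM l i j; have := good bM; rewrite finset.in_setU negb_or => /andP[_].
rewrite finset.in_set => /existsPn/(_ l)/existsPn/(_ i)/existsPn/(_ j).
by rewrite -leNgt.
Qed.

Let Pbump i b : P (bump_at i 1 b) = P b + torus_unit p i *+ S.
Proof. by rewrite /P subcell_bump torus_ptD. Qed.

Let z0 : zn := U (fold_pos L (P (fun=> 0%N))).
Let D (i : 'I_k) : zn := U (fold_pos L (P (bump_at i 1 (fun=> 0%N)))) - z0.

Let bump0M (i : 'I_k) : forall l, (bump_at i 1 (fun=> 0) l < M)%N.
Proof. by move=> l; rewrite /bump_at add0n muln1; case: (l == i). Qed.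

Let P_in_cell b : (forall l, b l < M)%N ->
  in_cell (M ^ g.+1) (fun l => Q l * M + b l)%N (fold_pos L (P b) : 'rV[R]_k).
Proof.
move=> bM l; rewrite /P (fold_pos_pt pL (cL bM)) mxE.
have SR : 0 < S%:R :> R by rewrite ltr0n expn_gt0 M0.
have -> : (M ^ g.+1)%:R * ((subcell M S Q b t l)%:R / L%:R) = (subcell M S Q b t l)%:R / S%:R :> R.
  have /(congr1 (fun x => x^-1)) := hE; rewrite invrK => ->.
  by field; rewrite !lt0r_neq0// ltr0n.
rewrite ler_pdivlMr// ltr_pdivrMr// -!natrM ler_nat ltr_nat /subcell.
by apply/andP; split; [exact: leq_addr|rewrite mulSn addnC ltn_add2r].
Qed.

Let D_le i : `|D i| <= C * h.
Proof.
rewrite /D; apply: (le_trans (Ulip _ _)).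
pose o : 'I_k -> nat := fun=> 0%N.
have oM l : (o l < M)%N by [].
have H : `|fold_pos L (P (bump_at i 1 o)) - fold_pos L (P o) : 'rV[R]_k| <= 2 * h.
  apply: (in_cell_dist (a := 1) G0 (P_in_cell (bump0M i)) (P_in_cell oM)) => l.
  by rewrite /bump_at /o add0n muln1; case: (l == i) => /=; lia.
have B0' := B0; apply: (le_trans (ler_wpM2l (ltW B0) H)).
have h0 : 0 < h by rewrite invr_gt0 ltr0n.
have Bh : 0 <= B * h by rewrite mulr_ge0// ltW.
lra.
Qed.

(** Moving from [e] to the grid point of its cell costs B h by the Lipschitz bound; the affine
    approximation at that grid point costs h. *)
Let affine b e : (forall l, b l < M)%N -> E e ->
  in_cell (M ^ g.+1) (fun l => Q l * M + b l)%N e ->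
  `|(f e).1 - z0 - \sum_i (b i)%:R *: D i| <= C * h.
Proof.
move=> bM Ee ce; have B0' := B0.
have h0 : 0 < h by rewrite invr_gt0 ltr0n.
have e_le : `|(f e).1 - U (fold_pos L (P b))| <= B * h.
  rewrite -(UE Ee); apply: (le_trans (Ulip _ _)); rewrite ler_wpM2l ?(ltW B0')//.
  rewrite -[h]mul1r; apply: (in_cell_dist (a := 0) G0 ce (P_in_cell bM)) => l.
  by rewrite addn0.
have u_le : `|U (fold_pos L (P b)) - z0 - \sum_i (b i)%:R *: D i| <= h.
  apply: znorm_le => [|l]; first exact: ltW.
  have := @approx_affine R k (fun b => fam l (P b)) M (delta * (S%:R * eta)).
  have d0 : 0 <= delta * (S%:R * eta).
    by rewrite mulr_ge0 ?invr_ge0 ?mulr_ge0 ?sqr_ge0 ?invr_ge0// ltW.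
  move=> /(_ d0 _ b bM)/le_trans H.
  rewrite !zcoordB zcoord_sum.
  under eq_bigr do rewrite zcoordB.
  apply: H => [b' i j b'M|].
    rewrite !Pbump [P b' + _ + _]addrAC; apply: le_trans (Pmixed b'M l i j).
    by rewrite /fdiff opprD opprK addrA.
  rewrite le_eqVlt; apply/orP; left; apply/eqP; rewrite hE; field.
  by rewrite !pnatr_eq0 -!lt0n L0 k0 lt0r_neq0//= andbT; lia.
have -> : (f e).1 - z0 - \sum_i (b i)%:R *: D i = ((f e).1 - U (fold_pos L (P b))) +
    (U (fold_pos L (P b)) - z0 - \sum_i (b i)%:R *: D i).
  by rewrite !addrA subrK.
apply: (le_trans (ler_normD _ _)); have Bh : 0 <= B * h by rewrite mulr_ge0// ltW.
lra.
Qed.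

Lemma good_cube_key : exists key : ('I_k -> nat) -> keys,
  forall b b' e e', (forall i, b i < M)%N -> (forall i, b' i < M)%N -> E e -> E e' ->
    in_cell (M ^ g.+1) (fun l => Q l * M + b l)%N e ->
    in_cell (M ^ g.+1) (fun l => Q l * M + b' l)%N e' ->
    key b = key b' -> (dcc (f e) (f e') <= (K * r0%:R * h)%:E)%E.
Proof.
pose F (b : 'I_k -> nat) (q : heisn) :=
  exists e, [/\ E e, q = f e & in_cell (M ^ g.+1) (fun l => Q l * M + b l)%N e].
have h0 : 0 < h by rewrite invr_gt0 ltr0n.
have C0 : 0 <= C by have := B0; lra.
have Fex b : (forall i, b i < M)%N -> exists q, F b q.
  by move=> bM; have [e Ee ce] := Pmet bM; exists (f e), e.
have Ftau b b' q q' : (forall i, b i < M)%N -> (forall i, b' i < M)%N ->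
    F b q -> F b' q' -> (forall i, b i <= (b' i).+1 /\ b' i <= (b i).+1)%N ->
    `|tau q q'| <= C * h ^+ 2.
  move=> bM b'M [e [Ee -> ce]] [e' [Ee' -> ce']] bb'.
  apply: (le_trans (ftau Ee Ee')).
  have le2 : `|e - e'| <= 2 / (M ^ g.+1)%:R.
    apply: in_cell_dist ce ce' _ => // l; have := bb' l; lia.
  have : `|e - e'| ^+ 2 <= (2 * h) ^+ 2 by rewrite lerXn2r ?nnegrE// mulr_ge0// ltW.
  move=> /(ler_wpM2l (ltW B0)); have := sqr_ge0 h; rewrite exprMn; lra.
have Fz b q : (forall i, b i < M)%N -> F b q ->
    `|q.1 - z0 - \sum_i (b i)%:R *: D i| <= C * h.
  by move=> bM [e [Ee -> ce]]; exact: affine.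
have [key Hkey] := cube_key n0 nk h0 C0 M2 Fex Ftau Fz D_le (ltnW r02) erefl.
exists key => b b' e e' bM b'M Ee Ee' ce ce' kk.
by apply: (Hkey b b') => //; [exists e|exists e'].
Qed.
End OneCube.

Definition bad_cubes (g : nat) : {set {ffun 'I_k -> 'I_(M ^ g)}} :=
  [set Q | [forall t : {ffun 'I_k -> 'I_(M ^ (N - g.+1))},
    exists b : {ffun 'I_k -> 'I_M},
      torus_pt p (subcell M (M ^ (N - g.+1)) (nats Q) (nats b) (nats t))
        \in bad_points M (torus_unit p) fam met eta delta N g]].

Lemma cube_cover g (Q : {ffun 'I_k -> 'I_(M ^ g)}) : (g < N)%N ->
  exists (W : keys -> set heisn) (r : keys -> R), [/\
    forall e, E e -> in_cell (M ^ g) (nats Q) e -> exists ka, W ka (f e),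
    forall ka q q', W ka q -> W ka q' -> (dcc q q' <= (r ka)%:E)%E,
    forall ka, 0 <= r ka <= (B + K) / (M ^ g)%:R &
    \sum_ka r ka ^+ k <= if Q \in bad_cubes g then (B / (M ^ g)%:R) ^+ k else
      (3 * r0)%:R ^+ k.-1 * (K * r0%:R / (M ^ g.+1)%:R) ^+ k].
Proof.
move=> gN; have B0' := B0; have K0 : 0 <= K by apply: cube_const_ge0; lra.
have Gg0 : (0 < M ^ g)%N by rewrite expn_gt0 M0.
have GR : 0 < (M ^ g)%:R :> R by rewrite ltr0n.
have BK0 : 0 <= (B + K) / (M ^ g)%:R by rewrite divr_ge0//; lra.
have [Qbad|Qgood] := boolP (Q \in bad_cubes g).
  pose ka0 : keys := [ffun=> ord0].
  exists (fun ka q => ka = ka0 /\ exists e, [/\ E e, in_cell (M ^ g) (nats Q) e & q = f e]).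
  exists (fun ka => if ka == ka0 then B / (M ^ g)%:R else 0); split.
  - by move=> e Ee ce; exists ka0; split => //; exists e.
  - move=> ka q q' [-> [e [Ee ce ->]]] [_ [e' [Ee' ce' ->]]]; rewrite eqxx.
    apply: (le_trans (fd Ee Ee')); rewrite lee_fin ler_pM2l//.
    by rewrite -[leRHS]mul1r; apply: (in_cell_dist (a := 0) Gg0 ce ce') => l; rewrite addn0.
  - move=> ka; case: eqP => _; last by rewrite lexx.
    by rewrite divr_ge0 ?(ltW B0')//= ler_pM2r ?invr_gt0//; lra.
  - rewrite (bigD1 ka0)//= eqxx big1 ?addr0// => ka /negbTE ->.
    by rewrite expr0n; case: (k) k0.
have [Qmet|Qmet] := pselect (meets (M ^ g) (nats Q)); last first.
  exists (fun _ _ => False), (fun=> 0); split => //.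
  - by move=> e Ee ce; case: Qmet; exists e.
  - by move=> ka; rewrite lexx.
  - rewrite big1 => [|ka _]; last by rewrite expr0n; case: (k) k0.
    have r00 : 0 <= K * r0%:R / (M ^ g.+1)%:R by rewrite divr_ge0// mulr_ge0.
    by rewrite mulr_ge0 ?exprn_ge0.
have [t Ht] : exists t : {ffun 'I_k -> 'I_(M ^ (N - g.+1))},
    forall b : {ffun 'I_k -> 'I_M},
      torus_pt p (subcell M (M ^ (N - g.+1)) (nats Q) (nats b) (nats t))
        \notin bad_points M (torus_unit p) fam met eta delta N g.
  move: Qgood; rewrite finset.in_set negb_forall => /existsP[t].
  by rewrite negb_exists => /forallP Ht; exists t.
have good (b : 'I_k -> nat) : (forall l, b l < M)%N ->
    torus_pt p (subcell M (M ^ (N - g.+1)) (nats Q) b (nats t))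
        \notin bad_points M (torus_unit p) fam met eta delta N g.
  move=> bM; have -> : b = nats [ffun l => Ordinal (bM l)]; last exact: Ht.
  by apply/funext => l; rewrite /nats ffunE.
have [key Hkey] := good_cube_key gN (nats_lt Q) (nats_lt t) good Qmet.
exists (fun ka q => exists b e, [/\ forall i, (b i < M)%N, E e, q = f e,
    in_cell (M ^ g.+1) (fun l => nats Q l * M + b l)%N e & key b = ka]).
exists (fun=> K * r0%:R / (M ^ g.+1)%:R); split.
- move=> e Ee ce; have G10 : (0 < M ^ g.+1)%N by rewrite expn_gt0 M0.
  have [c cc] := in_cell_exists G10 (E01 Ee).
  (* If [c] is the index of the smaller cell of [e], its quotient by M is [Q] and its remainder is
     the cell inside [Q]. *)
  exists (key (fun l => nats c l %% M)%N), (fun l => nats c l %% M)%N, e; split => //.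
    by move=> i; rewrite ltn_mod.
  have QE : nats Q = (fun l => nats c l %/ M)%N.
    by apply: in_cell_uniq ce _; apply: in_cell_div => //; rewrite -expnSr.
  by rewrite QE => l; rewrite -divn_eq; exact: cc.
- move=> ka q q' [b [e [bM Ee -> ce <-]]] [b' [e' [b'M Ee' -> ce' kk]]].
  exact: (Hkey _ _ _ _ bM b'M Ee Ee' ce ce').
- move=> ka; rewrite divr_ge0 ?(mulr_ge0 K0)//=.
  have -> : K * r0%:R / (M ^ g.+1)%:R = (K / r0%:R) / (M ^ g)%:R.
    rewrite expnSr natrM natrX; field.
    by rewrite -natrX lt0r_neq0 //= pnatr_eq0; lia.
  rewrite ler_pM2r ?invr_gt0// ler_pdivrMr ?ltr0n ?(ltnW r02)//.
  have : 1 <= r0%:R :> R by rewrite ler1n ltnW.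
  nra.
- rewrite /= sumr_const card_ffun !card_ord -[leLHS]mulr_natl.
  have -> : ((3 * r0).-1.+1 = 3 * r0)%N by have := r02; lia.
  by rewrite natrX.
Qed.

Lemma card_bad_cubes_le g : (g < N)%N ->
  (#|bad_cubes g| * (M ^ (N - g.+1)) ^ k <=
   #|bad_points M (torus_unit p) fam met eta delta N g|)%N.
Proof.
move=> gN; apply: card_bad_cubes; rewrite pL -expnSr -expnD subnKC//.
by rewrite leq_pmull.
Qed.

(** There are (2 L)^k torus points, each bad cube uses up S^k bad ones and costs (B / M^g)^k; since
    L = M^g M S, the factor (2 M B)^k remains, independent of g and N. *)
Definition bad_const : R :=
  (2 * M%:R * B) ^+ k * (1 + (n + n)%:R * k%:R ^+ 2 * M%:R ^+ 2 / delta ^+ 2).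

Lemma scale_cover : exists (J : finType) (W : J -> set heisn) (r : J -> R), [/\
    forall e, E e -> exists j, W j (f e),
    forall j q q', W j q -> W j q' -> (dcc q q' <= (r j)%:E)%E,
    forall j, 0 <= r j <= (B + K) / (M ^ g0)%:R &
    \sum_j r j ^+ k <= 3 ^+ k.-1 * K ^+ k / r0%:R + bad_const / (N - g0)%:R].
Proof.
have B0' := B0; have K0 : 0 <= K by apply: cube_const_ge0; lra.
have MR : 0 < M%:R :> R by rewrite ltr0n.
have eta0 : 0 < eta by rewrite divr_gt0 ?ltr0n.
have delta0 : 0 < delta by rewrite invr_gt0 mulr_gt0// exprn_gt0// ltr0n muln_gt0 k0 M0.
have [g /andP[g0g gN] few] := few_bad_points M2 gN0 eta0 delta0 fam_lip met_dec.
have GR : 0 < (M ^ g)%:R :> R by rewrite ltr0n expn_gt0 M0.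
have /choice[W /choice[r HW]] := fun Q => cube_cover Q gN.
exists ({ffun 'I_k -> 'I_(M ^ g)} * keys)%type, (fun j => W j.1 j.2), (fun j => r j.1 j.2).
split.
- move=> e Ee; have [Q cQ] := in_cell_exists (ltac:(by rewrite expn_gt0 M0) : (0 < M ^ g)%N) (E01 Ee).
  by have [/(_ e Ee cQ)[ka Wka] _ _ _] := HW Q; exists (Q, ka).
- by move=> [Q ka] q q' /=; have [_ + _ _] := HW Q; apply.
- move=> [Q ka] /=; have [_ _ /(_ ka)/andP[-> /le_trans H] _] := HW Q; apply: H.
  have BK : 0 <= B + K by lra.
  have Gle : (M ^ g0)%:R <= (M ^ g)%:R :> R by rewrite ler_nat leq_exp2l.
  have G0R : 0 < (M ^ g0)%:R :> R by rewrite ltr0n expn_gt0 M0.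
  by apply: ler_wpM2l => //; rewrite lef_pV2.
- rewrite -(pair_bigA _ (fun Q ka => r Q ka ^+ k)) /=.
  pose cg : R := (3 * r0)%:R ^+ k.-1 * (K * r0%:R / (M ^ g.+1)%:R) ^+ k.
  pose cb : R := (B / (M ^ g)%:R) ^+ k.
  have cg0 : 0 <= cg.
    have r00 : 0 <= K * r0%:R / (M ^ g.+1)%:R by rewrite divr_ge0// mulr_ge0.
    by rewrite mulr_ge0 ?exprn_ge0.
  have cb0 : 0 <= cb by rewrite exprn_ge0// divr_ge0// ltW.
  (* Every cube is charged the good cost. The (M^g)^k cubes then cost 3^(k-1) K^k / r0 in all, since
     M^(g+1) = M^g r0^2; the bad ones are charged [cb] in addition. *)
  apply: (@le_trans _ _ (\sum_(Q : {ffun 'I_k -> 'I_(M ^ g)}) (cg + (Q \in bad_cubes g)%:R * cb))).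
    apply: ler_sum => Q _; have [_ _ _ /le_trans] := HW Q; apply.
    case: (Q \in bad_cubes g) => /=; rewrite -/cb -/cg.
      by rewrite mul1r lerDr.
    by rewrite mul0r addr0.
  rewrite big_split /= sumr_const card_ffun !card_ord -mulr_suml; apply: lerD.
    rewrite -[leLHS]mulr_natl /cg.
    have -> : (M ^ g.+1)%:R = (M ^ g)%:R * r0%:R ^+ 2 :> R.
      by rewrite (expnSr M) natrM; congr (_ * _); rewrite natrX.
    have -> : ((M ^ g) ^ k)%:R = (M ^ g)%:R ^+ k :> R by rewrite natrX.
    have r0R : r0%:R != 0 :> R by rewrite pnatr_eq0; have := r02; lia.
    move: (M ^ g)%:R GR (lt0r_neq0 GR) => G _ G0.
    have -> : K * r0%:R / (G * r0%:R ^+ 2) = K / (G * r0%:R) by field; rewrite r0R G0.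
    rewrite natrM !exprMn exprVn exprMn -[in r0%:R ^+ k](prednK k0) exprS.
    by rewrite le_eqVlt; apply/orP; left; apply/eqP; field; rewrite r0R !expf_neq0.
  have -> : \sum_(Q : {ffun 'I_k -> 'I_(M ^ g)}) (Q \in bad_cubes g)%:R = #|bad_cubes g|%:R :> R.
    rewrite -sum1_card natr_sum [RHS]big_mkcond /=; apply: eq_bigr => Q _.
    by case: (Q \in _).
  have Sk0 : 0 < ((M ^ (N - g.+1)) ^ k)%:R :> R by rewrite ltr0n expn_gt0 expn_gt0 M0.
  have cnt : #|bad_cubes g|%:R * ((M ^ (N - g.+1)) ^ k)%:R <= #|'rV['I_p.+1]_k|%:R *
     (1 + (n + n)%:R * k%:R ^+ 2 * M%:R ^+ 2 / delta ^+ 2) / (N - g0)%:R.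
    by apply: le_trans few; rewrite -natrM ler_nat card_bad_cubes_le.
  rewrite -(ler_pM2r Sk0) mulrAC; apply: (le_trans (ler_wpM2r cb0 cnt)).
  rewrite card_mx card_ord mul1n pL.
  have {1}-> : L = (M ^ g * M * M ^ (N - g.+1))%N by rewrite -expnSr -expnD subnKC.
  rewrite le_eqVlt; apply/orP; left; apply/eqP; rewrite /cb /bad_const.
  move: (1 + _) => q.
  have NR : (N - g0)%:R != 0 :> R by rewrite pnatr_eq0 -lt0n subn_gt0.
  move: (M ^ g)%N GR => G GR; move: (M ^ (N - g.+1))%N => S; move: (M)%N => m.
  rewrite !natrX !natrM !exprMn exprVn.
  by field; rewrite NR expf_neq0// lt0r_neq0.
Qed.
End Scale.
End UnitCube.

(** * Hausdorff measure *)

Lemma le_archimedean {R : realType} (a e : R) (m0 : nat) : 0 < e ->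
  exists2 m, (m0 <= m)%N & a <= e * m%:R.
Proof.
move=> e0; pose m := (Num.truncn (`|a| / e)).+1; exists (m0 + m)%N; first exact: leq_addr.
have am : `|a| / e < m%:R by rewrite truncnS_gt.
rewrite ltr_pdivrMr// in am; apply: (le_trans (ler_norm a)); apply: (le_trans (ltW am)).
by rewrite mulrC ler_pM2l// ler_nat leq_addl.
Qed.

Section UnitCubeCover.
Context {R : realType} {n k : nat}.
Hypotheses (n0 : (0 < n)%N) (nk : (n < k)%N).
Notation heisn := (heis R n).

Lemma unit_cube_cover (E : set 'rV[R]_k) (f : 'rV[R]_k -> heisn) (B e d : R) : 1 <= B ->
  (forall x, E x -> forall l, 0 <= x ord0 l < 1) ->
  (forall x y, E x -> E y -> `|(f x).1 - (f y).1| <= B * `|x - y|) ->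
  (forall x y, E x -> E y -> `|tau (f x) (f y)| <= B * `|x - y| ^+ 2) ->
  (forall x y, E x -> E y -> (dcc (f x) (f y) <= (B * `|x - y|)%:E)%E) ->
  0 < e -> 0 < d ->
  exists (J : finType) (W : J -> set heisn) (r : J -> R), [/\
    f @` E `<=` \bigcup_j W j,
    forall j p q, W j p -> W j q -> (dcc p q <= (r j)%:E)%E,
    forall j, 0 <= r j <= d & \sum_j r j ^+ k <= e].
Proof.
move=> B1 E01 fz ftau fd e0 d0.
have [U [UE Ulip]] := z_extension B1 fz.
have B0 : 0 < B by apply: lt_le_trans B1.
set K := cube_const n k (4 * B + 1).
have K0 : 0 <= K by apply: cube_const_ge0; lra.
have ehalf : 0 < e / 2 by rewrite divr_gt0.
(* [K] does not depend on [r0], so [r0] can make the good cost small. [bad_const] depends on [r0]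
   but not on the number of scales, which is therefore chosen last. *)
have [r0 r02 Hr0] := le_archimedean (3 ^+ k.-1 * K ^+ k) 2 ehalf.
have [g0 _ Hg0] := le_archimedean (B + K) 0 d0.
have [N gN HN] := le_archimedean (bad_const (n := n) (k := k) B r0) 1 ehalf.
have gN' : (g0 < g0 + N)%N by rewrite -[X in (X < _)%N]addn0 ltn_add2l.
have [J [W [r [cov dW rle sumr]]]] := scale_cover n0 nk B1 E01 ftau fd r02 gN' UE Ulip.
exists J, W, r; split => //.
- by move=> _ [x Ex <-]; have [j Wj] := cov x Ex; exists j.
- move=> j; have /andP[-> /le_trans H] := rle j; apply: H.
  have M1 : (1 < r0 ^ 2)%N by rewrite -mulnn; nia.
  have G0 : 0 < ((r0 ^ 2) ^ g0)%:R :> R by rewrite ltr0n expn_gt0 ltnW.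
  rewrite ler_pdivrMr//; apply: (le_trans Hg0); rewrite ler_pM2l// ler_nat.
  by rewrite ltnW// ltn_expl.
- apply: (le_trans sumr); rewrite [leRHS]splitr; apply: lerD.
    by rewrite ler_pdivrMr// ltr0n; apply: leq_trans r02.
  by rewrite addKn ler_pdivrMr// ltr0n.
Qed.
End UnitCubeCover.

Section Hausdorff.
Context {R : realType} {n : nat}.
Notation heisn := (heis R n).
Local Open Scope ereal_scope.

Lemma dcc_ge0 (p q : heisn) : 0 <= dcc p q.
Proof.
apply/le_ereal_inf_tmp => _ [a [b [gamma [_ _ _ _ ->]]]].
by apply: integral_ge0 => x _; rewrite lee_fin hnorm_ge0.
Qed.

Lemma diam_pow_ge0 k (A : set heisn) : 0 <= diam_pow (@dcc R n) k A.
Proof.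
rewrite /diam_pow; case: eqP => // /eqP/set0P[x Ax]; apply: expe_ge0.
by apply: (le_trans (dcc_ge0 x x)); apply: ereal_sup_ubound; exists x => //; exists x.
Qed.

Lemma diam_le (A : set heisn) (r : R) :
  (forall p q, A p -> A q -> dcc p q <= r%:E) -> diam (@dcc R n) A <= r%:E.
Proof. by move=> H; apply/ge_ereal_sup => _ [x Ax [y Ay <-]]; exact: H. Qed.

Lemma diam_pow_le k (A : set heisn) (r : R) : (0 <= r)%R ->
  (forall p q, A p -> A q -> dcc p q <= r%:E) ->
  diam_pow (@dcc R n) k A <= (r ^+ k)%:E.
Proof.
move=> r0 H; rewrite /diam_pow; case: eqP => [_|/eqP/set0P[x Ax]].
  by rewrite lee_fin exprn_ge0.
rewrite EFin_expe; have dr := diam_le H.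
have d0 : 0 <= diam (@dcc R n) A.
  by apply: (le_trans (dcc_ge0 x x)); apply: ereal_sup_ubound; exists x => //; exists x.
by elim: k => // m IH; rewrite !expeS lee_pmul// expe_ge0.
Qed.

(** Padding with empty sets is free, because [diam_pow] gives them the value 0. *)
Lemma finite_to_sequence (J : finType) (W : J -> set heisn) (r : J -> R) k (e : R) :
  (forall j, 0 <= r j)%R -> (\sum_j r j ^+ k <= e)%R ->
  exists (V : nat -> set heisn) (a : nat -> \bar R), [/\
    \bigcup_j W j `<=` \bigcup_m V m,
    forall m, (exists j, V m = W j /\ a m = (r j ^+ k)%:E) \/ (V m = set0 /\ a m = 0) &
    \sum_(m <oo) a m <= e%:E].
Proof.
move=> r0 sumr; pose a m : \bar R :=
  if insub m is Some o then (r (enum_val (o : 'I_#|J|)) ^+ k)%:E else 0.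
have a0 m : 0 <= a m.
  by rewrite /a; case: insub => // o; rewrite lee_fin exprn_ge0.
exists (fun m => if insub m is Some o then W (enum_val (o : 'I_#|J|)) else set0), a; split.
- move=> x [j _ Wj]; exists (enum_rank j) => //=.
  by rewrite valK enum_rankK.
- by move=> m; rewrite /a; case: insubP => [u _ _|_]; [left; exists (enum_val u)|right].
- rewrite (nneseries_split _ #|J|)//= add0n [X in _ + X]eseries0 ?adde0.
    rewrite big_mkord (eq_bigr (fun o : 'I_#|J| => (r (enum_val o) ^+ k)%:E)); last first.
      by move=> o _; rewrite /a valK.
    rewrite sumEFin lee_fin; apply: le_trans sumr.
    by rewrite [leRHS](reindex _ (onW_bij _ (@enum_val_bij J))).
  move=> m Jm _; rewrite /a insubF//; apply/negbTE; rewrite -leqNgt; exact: Jm.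
Qed.

(** Countable subadditivity: the i-th piece is covered at cost e / 2^(i+1), and the double sequence
    of sets is enumerated by a bijection of nat with its square. *)
Lemma hausdorff_null k (A : nat -> set heisn) :
  (forall i (e d : R), (0 < e)%R -> (0 < d)%R ->
    exists (J : finType) (W : J -> set heisn) (r : J -> R), [/\
    A i `<=` \bigcup_j W j,
    forall j p q, W j p -> W j q -> dcc p q <= (r j)%:E,
    (forall j, 0 <= r j <= d)%R & (\sum_j r j ^+ k <= e)%R]) ->
  hausdorff_measure (@dcc R n) k (\bigcup_i A i) = 0.
Proof.
move=> cov; apply/eqP; rewrite eq_le; apply/andP; split; last first.
  apply: le_trans (ereal_sup_ubound _); last by exists 1%R => //=.
  apply/le_ereal_inf_tmp => _ [V _ <-]; apply: nneseries_ge0 => i _ _.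
  exact: diam_pow_ge0.
apply/ge_ereal_sup => _ [d /= d0 <-].
apply/lee_addgt0Pr => e e0; rewrite add0e.
have /choice[V /choice[a HV]] i : exists (V : nat -> set heisn) (a : nat -> \bar R), [/\
    A i `<=` \bigcup_m V m, forall m, diam (@dcc R n) (V m) <= d%:E,
    forall m, diam_pow (@dcc R n) k (V m) <= a m & \sum_(m <oo) a m <= (e / (2 ^ i.+1)%:R)%:E].
  have ei : (0 < e / (2 ^ i.+1)%:R)%R by rewrite divr_gt0// ltr0n expn_gt0.
  have [J [W [r [AW dW rd sumr]]]] := cov i _ _ ei d0.
  have r0 j : (0 <= r j)%R by have /andP[] := rd j.
  have [V [a [WV Va suma]]] := finite_to_sequence W r0 sumr.
  exists V, a; split => //; first exact: subset_trans WV.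
  - move=> m; case: (Va m) => [[j [-> _]]|[-> _]].
      apply: (le_trans (diam_le (dW j))); rewrite lee_fin.
      by have /andP[] := rd j.
    by apply/ge_ereal_sup => _ [x []].
  - move=> m; case: (Va m) => [[j [-> ->]]|[-> ->]]; last by rewrite /diam_pow eqxx.
    by apply: diam_pow_le => //; exact: dW.
have a0 x : 0 <= a x.1 x.2.
  by have [_ _ /(_ x.2) H _] := HV x.1; apply: le_trans H; exact: diam_pow_ge0.
have /card_esym/ppcard_eqP[p] := card_nat2.
apply: (@le_trans _ _ (\sum_(m <oo) a (p m).1 (p m).2)).
  apply: le_trans (ereal_inf_lbound _) _.
    exists (fun m => V (p m).1 (p m).2) => //; split.
      move=> x [i _ Aix]; have [/(_ x Aix)[m _ Vm] _ _ _] := HV i.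
      by exists (p^-1%FUN (i, m)) => //=; rewrite invK ?inE.
    by move=> m; have [_ + _ _] := HV (p m).1; apply.
  apply: lee_nneseries => m _; first by move=> _; exact: diam_pow_ge0.
  by have [_ _ + _] := HV (p m).1; apply.
rewrite nneseries_esumT; last by move=> m; exact: (a0 (p m)).
rewrite -(@reindex_esum _ _ _ [set: nat] [set: nat * nat] p (fun x => a x.1 x.2)); last exact: bij.
rewrite (_ : [set: nat * nat] = [set: nat] `*`` (fun=> [set: nat])); last by apply/seteqP.
rewrite -(esum_esum (a := a)); last by move=> i j _ _; exact: (a0 (i, j)).
apply: le_trans (epsilon_trick0 xpredT (ltW e0)).
rewrite nneseries_esumT; last by move=> i; rewrite lee_fin divr_ge0// ltW.
apply: le_esum => i _; rewrite -nneseries_esumT; last by move=> m; exact: (a0 (i, m)).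
by have [_ _ _] := HV i.
Qed.
End Hausdorff.

Lemma enorm_le {R : realType} {k : nat} (x : 'rV[R]_k) : enorm x <= k%:R * `|x|.
Proof.
have kx0 : 0 <= k%:R * `|x| by rewrite mulr_ge0.
rewrite -(ger0_norm kx0) -sqrtr_sqr ler_wsqrtr//.
apply: (@le_trans _ _ (\sum_(i < k) `|x| ^+ 2)).
  apply: ler_sum => i _; rewrite -[leLHS]real_normK ?num_real// lerXn2r ?nnegrE//.
  by rewrite [leRHS]/Num.norm/= mx_normrE; apply: (le_bigmax _ _ (ord0, i)).
rewrite sumr_const card_ord -[leLHS]mulr_natl exprMn ler_wpM2r ?sqr_ge0//.
by rewrite -natrX ler_nat; case: (k) => // m; rewrite -mulnn leq_pmulr.
Qed.

Theorem theorem1p1 (R : realType) (n k : nat) (hn : (0 < n)%N) (hk : (n < k)%N)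
    (E : set 'rV[R]_k) (hE : lebesgue_measurable_set E)
    (f : 'rV[R]_k -> heis R n) (hf : cc_lipschitz_on E f) :
  hausdorff_measure (@dcc R n) k (f @` E) = 0%E.
Proof.
have [L fL] := hf.
pose A (i : nat) : R := i.+1%:R.
(* The map [phi i] sends the half-open unit cube onto the cube [- A i, A i)^k; these cubes exhaust
   the space. *)
pose phi (i : nat) (x : 'rV[R]_k) : 'rV[R]_k := (2 * A i) *: x - const_mx (A i).
pose Ei i := [set x : 'rV[R]_k | (forall l, 0 <= x ord0 l < 1) /\ E (phi i x)].
have A0 i : 0 < A i by rewrite ltr0n.
have -> : f @` E = \bigcup_i ((f \o phi i) @` Ei i).
  apply/seteqP; split => [_ [x Ex <-]|_ [i _ [x [_ Ex] <-]]]; last by exists (phi i x).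
  have [i _ xi] := le_archimedean `|x| 0 (@ltr01 R); rewrite mul1r in xi.
  pose y : 'rV[R]_k := (2 * A i)^-1 *: (x + const_mx (A i)).
  have A2 : 0 < 2 * A i by rewrite mulr_gt0.
  have yx : phi i y = x by rewrite /phi scalerA divff ?gt_eqF// scale1r addrK.
  exists i => //; exists y; last by rewrite /= yx.
  split; last by rewrite yx.
  move=> l; rewrite !mxE ler_pdivlMl// mulr0 ltr_pdivrMl// mulr1.
  have : `|x ord0 l| < A i.
    apply: (@le_lt_trans _ _ i%:R); last by rewrite ltr_nat.
    apply: le_trans xi; rewrite [leRHS]/Num.norm/= mx_normrE.
    exact: (le_bigmax _ _ (ord0, l)).
  by rewrite ltr_norml => /andP[? ?]; apply/andP; split; lra.
apply: hausdorff_null => i e d e0 d0.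
(* The absolute value admits a negative [L], [k] compares the Euclidean norm with the sup norm, and
   2 A i is the dilation of [phi i]. *)
pose c := `|L| * k%:R * (2 * A i).
have c0 : 0 <= c by rewrite !mulr_ge0// ltW.
have dle x y : Ei i x -> Ei i y -> (dcc (f (phi i x)) (f (phi i y)) <= (c * `|x - y|)%:E)%E.
  move=> [_ Ex] [_ Ey]; apply: (le_trans (fL _ _ Ex Ey)); rewrite lee_fin.
  have en0 : 0 <= enorm (phi i x - phi i y) by exact: sqrtr_ge0.
  apply: (@le_trans _ _ (`|L| * enorm (phi i x - phi i y))).
    by rewrite ler_wpM2r// ler_norm.
  have -> : c * `|x - y| = `|L| * (k%:R * `|phi i x - phi i y|).
    have -> : phi i x - phi i y = (2 * A i) *: (x - y).
      by rewrite /phi opprB addrA subrK scalerBr.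
    by rewrite normrZ gtr0_norm ?mulr_gt0// /c; ring.
  by rewrite ler_wpM2l// enorm_le.
(* The infimum defining [dcc] need not be attained, and the lower bounds start from a strict
   inequality; enlarging [c] by 1 provides it for distinct points. *)
have dlt x y : Ei i x -> Ei i y -> x != y ->
    (dcc (f (phi i x)) (f (phi i y)) < ((c + 1) * `|x - y|)%:E)%E.
  move=> Ex Ey xy; apply: (le_lt_trans (dle x y Ex Ey)); rewrite lte_fin.
  by rewrite ltr_pM2r ?ltrDl// normr_gt0 subr_eq0.
(* One constant for all three hypotheses: it dominates c + 1 for the distance and the horizontal
   part, and 4 n (c + 1)^2 for [tau]. *)
pose B := (4 * n%:R + 1) * (c + 1) ^+ 2.
have c1 : 1 <= (c + 1) ^+ 2 by nra.
have n4 : 0 <= 4 * n%:R :> R by rewrite mulr_ge0.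
have cB : c + 1 <= B by rewrite /B; nra.
have nB : 4 * n%:R * (c + 1) ^+ 2 <= B by rewrite /B; nra.
apply: (@unit_cube_cover R n k hn hk (Ei i) (f \o phi i) B) => //=.
- lra.
- by move=> x [].
- move=> x y Ex Ey; have [->|xy] := eqVneq x y; first by rewrite !subrr !normr0 mulr0.
  rewrite distrC; apply: (le_trans (dcc_z_le (dlt x y Ex Ey xy))).
  by rewrite ler_wpM2r.
- move=> x y Ex Ey; have [->|xy] := eqVneq x y.
    by rewrite /tau omegaaa !subrr mulr0 addr0 !normr0 expr0n mulr0.
  apply: (le_trans (dcc_tau_le (dlt x y Ex Ey xy))).
  by rewrite exprMn mulrA ler_wpM2r ?sqr_ge0.
- move=> x y Ex Ey; apply: (le_trans (dle x y Ex Ey)); rewrite lee_fin ler_wpM2r//.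
  lra.
Qed.
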